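(* Let $G$ be the group of isometries of a separable locally compact metric space. If all orbit equivalence relations induced by Borel actions of $G$ on standard Borel spaces are essentially countable, then $G$ is locally compact.
   Context: The isometry group of a separable locally compact metric space is viewed as a Polish group with the topology of pointwise convergence. For a Polish group $G$, a Borel $G$-space is a standard Borel space $X$ together with a Borel action of $G$ on $X$. The orbit equivalence relation $E^G_X$ is defined by $x\,E^G_X\,x'$ if and only if $x$ and $x'$ have the same $G$-orbit. For analytic equivalence relations $E$, $F$ on standard Borel spaces $X$, $Y$, $E\leq_B F$ ($E$ Borel reduces to $F$) means that there is a Borel map $f\colon X\to Y$ such that $x\,E\,x' \iff f(x)\,F\,f(x')$ for all $x,x'\in X$. A Borel equivalence relation is countable if each of its classes is countable. An equivalence relation $E$ is essentially countable if $E\leq_B F$ for some countable Borel equivalence relation $F$ (on a standard Borel space). *)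

(* Defs.v *)
From HB Require Import structures.
From Stdlib Require Export RelationClasses.
From mathcomp Require Export all_boot all_order all_algebra.
From mathcomp Require Export all_classical all_reals all_analysis.

Set Implicit Arguments.
Unset Strict Implicit.
Unset Printing Implicit Defensive.

Import Order.TTheory GRing.Theory Num.Theory.

Local Open Scope classical_set_scope.
Local Open Scope ring_scope.

Definition separable_space (T : topologicalType) :=
  exists2 S : set T, countable S & dense S.

#[short(type="completeMetricType")]
HB.structure Definition CompleteMetric (R : numDomainType) :=
  {T of Metric R T & Complete T}.

HB.mixin Record isTopologicalGroup G of Topological G & Group G := {
  mulg_continuous : continuous (fun x : G * G => (x.1 * x.2)%g) ;
  invg_continuous : continuous (fun x : G => (x^-1)%g)
}.

(* Pointed is needed for Borel sets: measurableType inherits pointedType. *)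
#[short(type="topologicalGroupType")]
HB.structure Definition TopologicalGroup :=
  {G of PointedTopological G & Group G & isTopologicalGroup G}.

Definition borel (T : ptopologicalType) := g_sigma_algebraType (@open T).
HB.instance Definition _ (T : ptopologicalType) := Measurable.on (borel T).

(* Being a measurableType, X is nonempty; the empty standard Borel space is
   thus left out, which is harmless here: the only relation on it reduces to
   any other one. *)
Definition standard_borel (R : realType) d (X : measurableType d) :=
  exists (P : completeMetricType R) (f : X -> borel P),
    [/\ separable_space P, bijective f &
        forall A : set X, measurable A <-> measurable (f @` A)].

Definition borel_reducible d d' (X : measurableType d) (Y : measurableType d')
    (E : X -> X -> Prop) (F : Y -> Y -> Prop) :=
  exists2 f : X -> Y, measurable_fun setT f &
    forall x x', E x x' <-> F (f x) (f x').

Record countable_borel_equivalence d (X : measurableType d)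
    (E : X -> X -> Prop) : Prop := CountableBorelEquivalence {
  cber_equiv : Equivalence E ;
  cber_borel : measurable [set p : X * X | E p.1 p.2] ;
  cber_countable : forall x, countable [set y | E x y]
}.

Definition essentially_countable (R : realType) d (X : measurableType d)
    (E : X -> X -> Prop) :=
  exists d' (Y : measurableType d') (F : Y -> Y -> Prop),
    [/\ standard_borel R Y, countable_borel_equivalence F &
        borel_reducible E F].

Record borel_action (G : topologicalGroupType) d (X : measurableType d)
    (act : G -> X -> X) : Prop := BorelAction {
  borel_act1 : forall x, act 1%g x = x ;
  borel_actM : forall g h x, act (g * h)%g x = act g (act h x) ;
  borel_act_measurable :
    measurable_fun [set: borel G * X] (fun p => act p.1 p.2)
}.

Definition orbit_equivalence (G X : Type) (act : G -> X -> X) (x x' : X) :=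
  exists g, act g x = x'.

Record isometryGroup (R : realType) (M : metricType R) := Isometry {
  isometry_fun :> M -> M ;
  isometry_dist :
    forall x y, mdist (isometry_fun x) (isometry_fun y) = mdist x y ;
  isometry_surj : forall y, exists x, isometry_fun x = y
}.

Section isometry_group.
Context {R : realType} {M : metricType R}.
Implicit Types g h : isometryGroup M.

Lemma isometryP g h : g =1 h -> g = h.
Proof.
case: g h => [f df sf] [f' df' sf'] /= /funext ff'; move: df' sf'.
by rewrite -ff' => df' sf'; congr Isometry; exact: Prop_irrelevance.
Qed.

Definition isometry1 : isometryGroup M :=
  @Isometry R M idfun (fun _ _ => erefl) (fun y => ex_intro _ y erefl).

Lemma isometry_comp_dist g h x y : mdist (g (h x)) (g (h y)) = mdist x y.
Proof. by rewrite !isometry_dist. Qed.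

Lemma isometry_comp_surj g h y : exists x, g (h x) = y.
Proof.
by have [z <-] := isometry_surj g y; have [x <-] := isometry_surj h z; exists x.
Qed.

Definition isometry_mul g h : isometryGroup M :=
  Isometry (isometry_comp_dist g h) (isometry_comp_surj g h).

Definition isometry_inv_fun g (y : M) : M := projT1 (cid (isometry_surj g y)).

Lemma isometry_inv_funK g : cancel (isometry_inv_fun g) g.
Proof. by move=> y; rewrite /isometry_inv_fun; case: cid. Qed.

Lemma isometry_inj g : injective g.
Proof.
move=> x y gxy; apply: (@mdist_positivity R).
by rewrite -(isometry_dist g) gxy mdistxx.
Qed.

Lemma isometry_funK g : cancel g (isometry_inv_fun g).
Proof. by move=> x; apply: (@isometry_inj g); rewrite isometry_inv_funK. Qed.

Lemma isometry_inv_dist g x y :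
  mdist (isometry_inv_fun g x) (isometry_inv_fun g y) = mdist x y.
Proof. by rewrite -(isometry_dist g) !isometry_inv_funK. Qed.

Lemma isometry_inv_surj g y : exists x, isometry_inv_fun g x = y.
Proof. by exists (g y); exact: isometry_funK. Qed.

Definition isometry_inv g : isometryGroup M :=
  Isometry (isometry_inv_dist g) (isometry_inv_surj g).

HB.instance Definition _ := gen_eqMixin (isometryGroup M).
HB.instance Definition _ := gen_choiceMixin (isometryGroup M).

Let mulA : associative isometry_mul.
Proof. by move=> f g h; apply: isometryP. Qed.

Let mul1 : left_id isometry1 isometry_mul.
Proof. by move=> g; apply: isometryP. Qed.

Let mulr1 : right_id isometry1 isometry_mul.
Proof. by move=> g; apply: isometryP. Qed.

Let mulV : left_inverse isometry1 isometry_inv isometry_mul.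
Proof. by move=> g; apply: isometryP; exact: isometry_funK. Qed.

Let mulrV : right_inverse isometry1 isometry_inv isometry_mul.
Proof. by move=> g; apply: isometryP; exact: isometry_inv_funK. Qed.

HB.instance Definition _ :=
  isGroup.Build (isometryGroup M) mulA mul1 mulr1 mulV mulrV.

HB.instance Definition _ := isPointed.Build (isometryGroup M) isometry1.

HB.instance Definition _ := Topological.copy (isometryGroup M)
  (initial_topology (@isometry_fun R M : isometryGroup M -> {ptws M -> M})).

Lemma isometry_cvgP (F : set_system (isometryGroup M)) g : Filter F ->
  F --> g <-> forall x, (fun h : isometryGroup M => h x) @ F --> g x.
Proof.
move=> FF; pose e : isometryGroup M -> {ptws M -> M} := @isometry_fun R M.
have ec : continuous e by exact: (@initial_continuous _ _ e).
have ptP := @pointwise_cvgP M M (e @ F) (e g) _.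
split=> [Fg|Fg].
  by apply/ptP => A /ec; exact: Fg.
move=> A [_ [[B oB <-] Bg] sBA]; apply: (filterS sBA).
by move/ptP: Fg; apply; exact: open_nbhs_nbhs.
Qed.

Lemma isometry_eval_cvg g x (e : R) : 0 < e ->
  nbhs g [set h : isometryGroup M | mdist (g x) (h x) < e].
Proof.
move=> e0; have /isometry_cvgP/(_ x)/cvg_ballP/(_ e e0) : g --> g by [].
by rewrite ballEmdist.
Qed.

Let mul_continuous :
  continuous (fun p : isometryGroup M * isometryGroup M => (p.1 * p.2)%g).
Proof.
move=> [g h]; apply/isometry_cvgP => x; apply/cvg_ballP => e e0.
have e20 : 0 < e / 2 by rewrite divr_gt0.
exists ([set g' : isometryGroup M | mdist (g (h x)) (g' (h x)) < e / 2],
        [set h' : isometryGroup M | mdist (h x) (h' x) < e / 2]).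
  by split; exact: isometry_eval_cvg.
move=> [g' h'] [/= gg' hh']; rewrite ballEmdist /=.
apply: (le_lt_trans (metric_triangle _ (g' (h x)) _)).
by rewrite [e in _ < e]splitr ltrD// isometry_dist.
Qed.

Let inv_continuous : continuous (fun g : isometryGroup M => (g^-1)%g).
Proof.
move=> g; apply/(isometry_cvgP _ (fmap_filter _ (nbhs_filter g))) => x.
apply/cvg_ballP => e e0.
have := isometry_eval_cvg g (isometry_inv_fun g x) e0.
rewrite !near_map; apply: filterS => h; rewrite isometry_inv_funK => gh.
by rewrite ballEmdist /= -(isometry_dist h) isometry_inv_funK metric_sym.
Qed.

HB.instance Definition _ :=
  isTopologicalGroup.Build (isometryGroup M) mul_continuous inv_continuous.

End isometry_group.

(* Main.v *)
From HB Require Import structures.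
Require Import Defs.
From mathcomp Require Import all_boot all_order all_algebra.
From mathcomp Require Import all_classical all_reals all_analysis.
From mathcomp Require Import lra.

(** Suppose that G = Iso(M) is not locally compact. Let X be the Polish space of
    sequences x = (x_i) of 1-Lipschitz functions on M with 0 <= x_i <= crad, where
    crad is a small G-invariant radius at which balls are relatively compact; G acts
    by x |-> x o g^-1. The orbit equivalence relation of X is not essentially
    countable.

    Let f be a Borel reduction of it to a relation with countable classes. On a
    comeager set C the map f is continuous, as far as a countable separating family
    of Borel sets can tell ([borel_map_generically_continuous]). For generic x, the
    set of the g with g x in C is comeager in G, and f takes countably many values
    on G x; by Baire category in G, f is constant on the points of C in V x for some
    nonempty open V ([constant_on_open]). By continuity f is constant on
    C `&` closure (V x), and since f is a reduction this set lies in the single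
    orbit G x.

    This is contradicted by showing that a generic point y of closure (V x) is not
    in G x. Shrink V to the set of the g with dist(h d_s, g d_s) < e for finitely
    many s, where h is in V. As G is not locally compact, there is a point b with
    V^-1 b not relatively compact ([relcompact_spread_locally_compact]), and this
    remains true when V is replaced by any smaller neighbourhood that controls the
    same points d_s ([spread_shrink]). Hence for g in V there are isometries k,
    nearly fixing the d_s, that carry g^-1 b away from any given compact set, while
    each of finitely many other points is either hardly moved or carried away as
    well ([exists_escaping]). At points carried far away a Lipschitz function can be
    prescribed freely; so, x being generic, k can be found such that g k^-1 x is
    close to g x and yet its i-th coordinate at b, which is x_i(k g^-1 b), exceeds
    x_i on a given ball B_j for some i ([escaping_extension], [wandering_dense]). So
    the points y of closure (V x) such that some y_i(b) exceeds x_i on B_j contain a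
    dense relatively open set ([exceeds_ball_dense]). Countably many such balls
    cover M, whereas y = g x would give y_i(b) = x_i(g^-1 b) for all i. *)

Set Implicit Arguments.
Unset Strict Implicit.
Unset Printing Implicit Defensive.
Import Order.TTheory GRing.Theory Num.Theory.
Import numFieldNormedType.Exports.
Local Open Scope classical_set_scope.
Local Open Scope ring_scope.

(** * Baire category *)

(** What the proof of the Baire category theorem needs of a complete metric:
    shrinkable neighbourhoods, and convergence of the filters with arbitrarily
    small members. Stated for a notion of smallness so as to cover the isometry
    group, whose topology does not come with a metric. *)
Definition complete_gauge (T : topologicalType) (small : nat -> set T -> Prop) :=
  (forall n x U, nbhs x U ->
     exists V, [/\ open V, V x, closure V `<=` U & small n V]) /\
  (forall F : set_system T, ProperFilter F ->
     (forall n, exists2 V, F V & small n V) -> exists l : T, F --> l).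

(** Relative to a closed set Z, since it is applied to the closure of a local
    orbit as well as to whole spaces. The countable family is turned into a
    sequence by [unpickle]. *)
Lemma baire_category (T : topologicalType) (small : nat -> set T -> Prop)
    (I : countType) (Z : set T)
    (O : I -> set T) :
  @complete_gauge T small -> closed Z -> (forall i, open (O i)) ->
  (forall i U, open U -> U `&` Z !=set0 -> U `&` Z `&` O i !=set0) ->
  forall U, open U -> U `&` Z !=set0 -> exists x, [/\ U x, Z x & forall i, O i x].
Proof.
move=> [shrink conv] cZ oO dO U oU UZ.
pose O' n := if unpickle n is Some i then O i else setT.
have step n (V : {V : set T | open V /\ V `&` Z !=set0}) :
    {W : {W : set T | open W /\ W `&` Z !=set0} |
      closure (sval W) `<=` sval V `&` O' n /\ small n (sval W)}.
  apply: cid; case: V => V [oV VZ] /=.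
  have [x [[Vx Zx] Ox]] : V `&` Z `&` O' n !=set0.
    rewrite /O'; case: unpickle => [i|]; first exact: dO.
    by rewrite setIT.
  have oVO : open (V `&` O' n).
    by apply: openI => //; rewrite /O'; case: unpickle => [i|]; [exact: oO|exact: openT].
  have [|W [oW Wx cW sW]] := shrink n x (V `&` O' n).
    exact: open_nbhs_nbhs.
  have WZ : W `&` Z !=set0 by exists x.
  by exists (exist _ W (conj oW WZ)).
pose V := fix V n := if n is m.+1 then sval (step m (V m))
  else exist (fun V : set T => open V /\ V `&` Z !=set0) U (conj oU UZ).
have VS n : closure (sval (V n.+1)) `<=` sval (V n) `&` O' n.
  by case: (svalP (step n (V n))).
have Vsmall n : small n (sval (V n.+1)).
  by case: (svalP (step n (V n))).
have Vle m n : (m <= n)%N -> sval (V n) `<=` sval (V m).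
  move/subnKC <-; elim: (n - m)%N => [|k ih]; first by rewrite addn0.
  by rewrite addnS => x /subset_closure/VS[/ih].
pose F := filter_from [set: nat] (fun n => sval (V n) `&` Z).
have FF : ProperFilter F.
  apply: filter_from_proper; last by move=> n _; case: (V n) => ? [].
  apply: filter_from_filter; first by exists 0%N.
  move=> m n _ _; exists (maxn m n) => // x [Vx Zx].
  by split; split=> //; apply: Vle Vx; rewrite ?leq_maxl ?leq_maxr.
have FV n : F (sval (V n)) by exists n => // x [].
have [n|l Fl] := conv F FF; first by exists (sval (V n.+1)).
have lV n : closure (sval (V n)) l.
  by move=> B /Fl FB; have [x] := filter_ex (filterI (FV n) FB); exists x.
exists l; split.
- by have [] := VS 0%N l (lV 1%N).
- apply: cZ => B /Fl FB.
  have FZ : F Z by exists 0%N => // x [].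
  by have [x] := filter_ex (filterI FZ FB); exists x.
- move=> i; have [_] := VS (pickle i) l (lV _).
  by rewrite /O' pickleK.
Qed.

Definition metric_small (R : realType) (T : metricType R) n (V : set T) :=
  forall x y, V x -> V y -> mdist x y < n.+1%:R^-1 :> R.

Lemma exists_invS (R : realType) (e : R) : 0 < e -> exists n, n.+1%:R^-1 < e.
Proof.
move=> e0; exists (Num.truncn e^-1); rewrite invf_plt ?posrE//.
by rewrite truncnS_gt.
Qed.

(** [metric_triangle] and [metric_sym] over a realType: the distances then are
    the same terms as in the other hypotheses, which [lra] requires. *)
Lemma real_metric_triangle (R : realType) (T : metricType R) (x y z : T) :
  mdist x z <= mdist x y + mdist y z :> R.
Proof. exact: metric_triangle. Qed.

Lemma real_metric_sym (R : realType) (T : metricType R) (x y : T) :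
  mdist x y = mdist y x :> R.
Proof. exact: metric_sym. Qed.

Lemma nbhs_mdist (R : realType) (T : metricType R) (x : T) (A : set T) :
  nbhs x A <-> exists2 e : R, 0 < e & forall y, mdist x y < e -> A y.
Proof.
rewrite -nbhs_ballE; split=> -[e /= e0 xA]; exists e => //.
  by move=> y xy; apply: xA; rewrite ballEmdist.
by move=> y; rewrite ballEmdist => /xA.
Qed.

Lemma open_mdist (R : realType) (T : metricType R) (x : T) (r : R) :
  open [set y | mdist x y < r].
Proof.
rewrite openE => y /= xy; apply/nbhs_mdist; exists (r - mdist x y).
  by rewrite subr_gt0.
by move=> z yz /=; rewrite (le_lt_trans (real_metric_triangle _ y _))// -ltrBrDl.
Qed.

Lemma metric_complete_gauge (R : realType) (T : completeMetricType R) :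
  complete_gauge (@metric_small R T).
Proof.
split=> [n x U /nbhs_mdist[e e0 eU]|F FF Fsmall]; last first.
  apply/cvg_ex; apply: cauchy_cvg; apply: cauchy_exP => e e0.
  have [n ne] := exists_invS e0; have [V FV sV] := Fsmall n.
  have [x Vx] := filter_ex FV; exists x; apply: filterS FV => y Vy.
  by rewrite ballEmdist /= (lt_trans _ ne)// sV.
pose r := Num.min (e / 2) (n.+1%:R^-1 / 2 : R).
have r0 : 0 < r by rewrite lt_min !divr_gt0//.
exists (ball x r)^°; split.
- exact: open_interior.
- by apply: nbhs_singleton; apply: nbhs_interior; exact: nbhsx_ballx.
- move=> y cy; apply: eU; have [|z []] := cy (ball y r); first exact: nbhsx_ballx.
  move=> /interior_subset; rewrite !ballEmdist /= => xz yz.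
  rewrite (le_lt_trans (real_metric_triangle _ z _))//; rewrite (real_metric_sym z).
  by move: xz yz; rewrite /r !lt_min => /andP[? _] /andP[? _]; lra.
- move=> y z /interior_subset + /interior_subset.
  rewrite !ballEmdist /= => xy xz.
  rewrite (le_lt_trans (real_metric_triangle _ x _))//; rewrite (real_metric_sym y).
  by move: xy xz; rewrite /r !lt_min => /andP[_ +] /andP[_ +];
  by move: (n.+1%:R^-1 : R) => t; lra.
Qed.

(** * Borel maps are continuous on a comeager set *)

Lemma countable_enum (T : Type) (S : set T) (p : T) : countable S ->
  exists e : nat -> T, forall q, S q -> exists n, e n = q.
Proof.
move=> /countable_injP[phi phi_inj].
exists (fun n => if pselect (exists q, S q /\ phi q = n) is left h
  then projT1 (cid h) else p) => q Sq; exists (phi q).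
case: pselect => [h|]; last by case; exists q.
by case: cid => q' [Sq' /phi_inj] /=; apply; rewrite inE.
Qed.

Lemma dense_enum (T : topologicalType) (p : T) : separable_space T ->
  exists e : nat -> T, forall U, open U -> U !=set0 -> exists n, U (e n).
Proof.
move=> [S cS dS]; have [e eS] := countable_enum p cS.
exists e => U oU U0; have [q [Uq /eS[n en]]] := dS U U0 oU.
by exists n; rewrite en.
Qed.


(** A form of the Baire property: A is relatively clopen in the intersection of
    the Q_i. *)
Definition generically_clopen (T : topologicalType) (A : set T) :=
  exists (I : countType) (Q : I -> set T),
    (forall i, open (Q i) /\ dense (Q i)) /\
    forall x, (forall i, Q i x) ->
      \forall z \near x, (forall i, Q i z) -> A z <-> A x.

Lemma boundary_complement_open_dense (T : topologicalType) (A : set T) :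
  open A -> open (A `|` (~` A)^°) /\ dense (A `|` (~` A)^°).
Proof.
move=> oA; split; first by apply: openU => //; exact: open_interior.
move=> U [x Ux] oU; have [UA|UA] := pselect (U `&` A !=set0).
  by have [y [Uy Ay]] := UA; exists y; split=> //; left.
exists x; split=> //; right; apply: filterS (open_nbhs_nbhs (conj oU Ux)).
by move=> y Uy Ay; apply: UA; exists y.
Qed.

Lemma open_generically_clopen (T : topologicalType) (A : set T) :
  open A -> generically_clopen A.
Proof.
move=> oA; exists unit, (fun=> A `|` (~` A)^°).
split=> [_|x /(_ tt)[Ax|nAx]]; first exact: boundary_complement_open_dense.
- by apply: filterS (open_nbhs_nbhs (conj oA Ax)) => z.
- have : nbhs x (~` A) by [].
  apply: filterS => z nAz _; split=> // Ax.
  by have := interior_subset nAx.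
Qed.

Lemma generically_clopenC (T : topologicalType) (A : set T) :
  generically_clopen A -> generically_clopen (~` A).
Proof.
move=> [I [Q [oQ QA]]]; exists I, Q; split=> // x /QA.
by apply: filterS => z zA /zA zx; split=> + Ax; apply; apply/zx.
Qed.

(** The union is relatively open in the common comeager set C, where it
    coincides with an open set W; removing the boundary of W makes it relatively
    clopen. *)
Lemma bigcup_generically_clopen (T : topologicalType) (A : nat -> set T) :
  (forall n, generically_clopen (A n)) -> generically_clopen (\bigcup_n A n).
Proof.
move=> /choice[I AQ]; pose Q k := projT1 (cid (AQ k)).
have QA k := projT2 (cid (AQ k)).
pose C := [set x | forall k i, Q k i x].
pose W := \bigcup_k [set z | C z -> A k z]^°.
have oW : open W by apply: bigcup_open => k _; exact: open_interior.
have CW x : C x -> (\bigcup_n A n) x <-> W x.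
  move=> Cx; split=> [[k _ Ax]|[k _ /interior_subset Ax]]; exists k => //.
    have := (QA k).2 x (Cx k); apply: filterS => z zx /(_ k) Cz.
    by apply/zx.
  exact: Ax.
exists (option {k : nat & I k}), (fun j => if j is Some (existT k i)
  then Q k i else W `|` (~` W)^°); split=> [[[k i]|]|x xO].
- exact: (QA k).1.
- exact: boundary_complement_open_dense.
- have Cz z : (forall j : option {k : nat & I k}, (if j is Some (existT k i)
      then Q k i else W `|` (~` W)^°) z) -> C z.
    by move=> zO k i; exact: (zO (Some (existT _ k i))).
  case: (xO None) => [Wx|nWx].
    apply: filterS (open_nbhs_nbhs (conj oW Wx)) => z Wz zO.
    by split=> _; apply/CW => //; exact: Cz.
  have : nbhs x (~` W) by [].
  apply: filterS => z nWz /Cz zO; split=> [Az|Ax].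
    by case: nWz; apply/(CW z zO).
  by case: (interior_subset nWx); apply/(CW x (Cz x xO)).
Qed.

Lemma borel_generically_clopen (T : ptopologicalType) (A : set (borel T)) :
  measurable A -> generically_clopen (A : set T).
Proof.
apply: smallest_sub => [|B]; last exact: open_generically_clopen.
split=> [|B /generically_clopenC|B]; last exact: bigcup_generically_clopen.
  by apply: open_generically_clopen; exact: open0.
by rewrite setTD.
Qed.

(** Balls around a countable dense set, with radii 1/(m+1), separate points. *)
Lemma standard_borel_separating (R : realType) d (Y : measurableType d) :
  standard_borel R Y -> exists B : nat * nat -> set Y,
    (forall k, measurable (B k)) /\
    forall y z, y <> z -> exists k, B k y /\ ~ B k z.
Proof.
move=> [P [f [sepP bij_f mf]]].
have [e eP] := dense_enum (point : P) sepP.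
have inj_f : injective f by case: bij_f => g /can_inj.
exists (fun k => f @^-1` [set p : P | mdist (e k.1) p < k.2.+1%:R^-1]).
split=> [k|y z yz].
  apply/mf; rewrite image_preimage; last first.
    by apply/seteqP; split=> // p _; case: bij_f => g _ gK; exists (g p).
  by apply: sub_sigma_algebra; exact: open_mdist.
have yz0 : 0 < mdist (f y : P) (f z).
  by rewrite mdist_gt0; apply/eqP => /inj_f.
have [m me] : exists m, m.+1%:R^-1 < mdist (f y : P) (f z) / 2.
  by apply: exists_invS; rewrite divr_gt0.
have [n yn] : exists n, mdist (f y : P) (e n) < m.+1%:R^-1.
  apply: (eP _ (open_mdist _ _)).
  by exists (f y); rewrite /= mdistxx.
exists (n, m); split; rewrite /= real_metric_sym// => zn.
 have := real_metric_triangle (f y : P) (e n) (f z); rewrite leNgt => /negP.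
by apply; rewrite (real_metric_sym (e n)); move: yn zn me; move: (m.+1%:R^-1 : R) => t; lra.
Qed.

(** Without any topology on Y, continuity on a comeager set is expressed by the
    countably many sets B k: each of them pulls back to a relatively clopen set.
    *)
Lemma borel_map_generically_continuous (T : ptopologicalType) d
    (Y : measurableType d) (f : borel T -> Y) (K : countType) (B : K -> set Y) :
  measurable_fun setT f -> (forall k, measurable (B k)) ->
  exists (I : countType) (Q : I -> set T),
    (forall i, open (Q i) /\ dense (Q i)) /\
    forall k x, (forall i, Q i x) ->
      \forall z \near x, (forall i, Q i z) -> B k (f z) <-> B k (f x).
Proof.
move=> mf mB.
have gen k : generically_clopen (f @^-1` B k : set T).
  apply: borel_generically_clopen; rewrite -[_ @^-1` _]setTI.
  exact: mf.
have [I BQ] := choice gen.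
pose Q k := projT1 (cid (BQ k)); have QB k := projT2 (cid (BQ k)).
exists {k : K & I k}, (fun j => Q (tag j) (tagged j)); split=> [[k i]|k x xO].
  exact: (QB k).1.
have := (QB k).2 x (fun i => xO (existT _ k i)); apply: filterS => z zx zO.
by apply: zx => i; exact: (zO (existT _ k i)).
Qed.

(** * Relative compactness in a locally compact metric space *)

(** A dense sequence together with an invariant, slowly varying radius of
    relative compactness. The constants leave room: with slope 1/4 and
    relatively compact balls of radius [3 * crad], a point at distance at least
    [3 * crad p] from p has radius at most (1/3 + 1/4) times this distance, so
    values between 0 and [crad] at the two points never conflict with the
    Lipschitz condition. *)
Record frame (R : realType) (M : metricType R) := Frame {
  pts : nat -> M ;
  pts_dense : forall p (e : R), 0 < e -> exists n, mdist p (pts n) < e ;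
  crad : M -> R ;
  crad_gt0 : forall p, 0 < crad p ;
  crad_le1 : forall p, crad p <= 1 ;
  crad_lip : forall p q, crad p <= crad q + mdist p q / 4 ;
  crad_isometry : forall (g : isometryGroup M) p, crad (g p) = crad p ;
  crad_compact : forall p, exists2 K : set M, compact K &
    [set q | mdist p q < 3 * crad p] `<=` K
}.

Section exists_frame.
Context {R : realType} {M : metricType R}.
Implicit Types (p q : M) (g : isometryGroup M).

Let compact_radii p : set R := [set t | 0 <= t <= 1 /\
  exists2 K : set M, compact K & [set q | mdist p q < t] `<=` K].

Let compact_radii0 p : compact_radii p 0.
Proof.
split; first by rewrite lexx ler01.
by exists set0; [exact: compact0|move=> q /=; rewrite ltNge mdist_ge0].
Qed.

Let has_sup_radii p : has_sup (compact_radii p).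
Proof.
by split; [exists 0; exact: compact_radii0|exists 1 => t [/andP[]]].
Qed.

Let sup_radii_ge0 p : 0 <= sup (compact_radii p).
Proof. exact: sup_upper_bound (has_sup_radii p) _ (compact_radii0 p). Qed.

Let sup_radii_lip p q :
  sup (compact_radii p) <= sup (compact_radii q) + mdist p q.
Proof.
apply: ge_sup; first by exists 0; exact: compact_radii0.
move=> t [/andP[t0 t1] [K cK tK]]; rewrite -lerBlDr.
have [tpq|tpq] := leP (mdist p q) t; last first.
  by rewrite (le_trans _ (sup_radii_ge0 q))// subr_le0 ltW.
apply: sup_upper_bound (has_sup_radii q) _ _; split.
  by rewrite subr_ge0 tpq (le_trans _ t1)// gerBl mdist_ge0.
exists K => // x /= qx; apply: tK => /=.
by rewrite (le_lt_trans (real_metric_triangle _ q _))// -ltrBrDl.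
Qed.

Lemma isometry_continuous g : continuous g.
Proof.
move=> p A /nbhs_mdist[e e0 eA]; apply/nbhs_mdist; exists e => // q pq.
by apply: eA; rewrite isometry_dist.
Qed.

Let sup_radii_isometry_le g p :
  sup (compact_radii p) <= sup (compact_radii (g p)).
Proof.
apply: ge_sup; first by exists 0; exact: compact_radii0.
move=> t [t01 [K cK tK]]; apply: sup_upper_bound (has_sup_radii _) _ _; split=> //.
exists (g @` K).
  by apply: continuous_compact => //; apply: continuous_subspaceT; exact: isometry_continuous.
move=> q /= pq; have [y yq] := isometry_surj g q; exists y => //.
by apply: tK; rewrite /= -(isometry_dist g) yq.
Qed.

(** A quarter of the supremum of the t <= 1 such that the t-ball around p is
    relatively compact: this supremum is 1-Lipschitz and is preserved by
    isometries. *)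
Lemma exists_frame (p0 : M) : separable_space M -> locally_compact [set: M] ->
  inhabited (frame M).
Proof.
move=> sepM lcM; have [e eP] := dense_enum p0 sepM.
have sup_gt0 p : 0 < sup (compact_radii p).
  have [U pU [cU _]] := lcM p I.
  have /nbhs_mdist[r r0 rU] : nbhs p U.
    by move: pU; rewrite withinET.
  apply: (@lt_le_trans _ _ (Num.min r 1)); first by rewrite lt_min r0 ltr01.
  apply: sup_upper_bound (has_sup_radii p) _ _; split.
    by rewrite le_min (ltW r0) ler01 ge_min lexx orbT.
  by exists U => // q /=; rewrite lt_min => /andP[pq _]; exact: rU.
constructor; apply: (@Frame R M e _ (fun p => sup (compact_radii p) / 4)).
- move=> p r r0; apply: (eP _ (open_mdist _ _)).
  by exists p; rewrite /= mdistxx.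
- by move=> p; rewrite divr_gt0.
- move=> p; suff : sup (compact_radii p) <= 1 by lra.
  apply: ge_sup; first by exists 0; exact: compact_radii0.
  by move=> t [/andP[]].
- by move=> p q; have := sup_radii_lip p q; lra.
- move=> g p; congr (_ / 4); apply/eqP; rewrite eq_le sup_radii_isometry_le andbT.
  have := sup_radii_isometry_le (isometry_inv g) (g p).
  by rewrite /= isometry_funK.
- move=> p; have [|t [_ [K cK tK]] pt] :=
    @sup_adherent _ (compact_radii p) (sup (compact_radii p) / 4) _ (has_sup_radii p).
    by rewrite divr_gt0.
  by exists K => // q /= pq; apply: tK => /=; move: pq pt; lra.
Qed.

End exists_frame.

Lemma uniform_bound (P : nat -> nat -> Prop) :
  (forall l m m', (m <= m')%N -> P l m -> P l m') ->
  (forall l, exists m, P l m) -> forall n, exists m, forall l, (l < n)%N -> P l m.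
Proof.
move=> P_mono exP; elim=> [|n [m mP]]; first by exists 0%N.
have [m' m'P] := exP n; exists (maxn m m') => l; rewrite ltnS leq_eqVlt.
move=> /predU1P[->|/mP]; first by apply: P_mono m'P; exact: leq_maxr.
by apply: P_mono; exact: leq_maxl.
Qed.

Section relative_compactness.
Context {R : realType} {M : metricType R} (F : frame M).
Implicit Types (A : set M) (p q : M).
Local Notation d := (pts F).
Local Notation r := (crad F).

(** Relative compactness (see [compact_relcompact] and
    [relcompact_sub_compact]), expressed by a cover by finitely many of the
    balls that cover M. *)
Definition relcompact A := exists n, forall p, A p ->
  exists2 l, (l < n)%N & mdist (d l) p < r (d l).

Lemma relcompact_sub A A' : A `<=` A' -> relcompact A' -> relcompact A.
Proof. by move=> AA' [n nA']; exists n => p /AA'/nA'. Qed.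

Lemma relcompactU A A' : relcompact A -> relcompact A' -> relcompact (A `|` A').
Proof.
move=> [n nA] [n' nA']; exists (maxn n n') => p [/nA|/nA'] [l ln lp]; exists l => //.
  by rewrite leq_max ln.
by rewrite leq_max ln orbT.
Qed.

Lemma relcompact_bigcup (A : nat -> set M) n : (forall l, relcompact (A l)) ->
  relcompact (\bigcup_(l < n) A l).
Proof.
move=> rA; have [l m m' mm' mA p /mA[k km kp]|m mP] := @uniform_bound
  (fun l m => forall p, A l p -> exists2 k, (k < m)%N & mdist (d k) p < r (d k))
  _ rA n.
  by exists k => //; exact: leq_trans mm'.
by exists m => p [l /= ln /(mP _ ln)].
Qed.

Lemma pts_rad p (c : R) : 0 < c -> c <= 1 ->
  exists l, mdist (d l) p < c * r (d l).
Proof.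
move=> c0 c1; have [|l lp] := @pts_dense _ _ F p (c * r p / 2).
  by rewrite divr_gt0// mulr_gt0// crad_gt0.
exists l; have := crad_lip F p (d l); rewrite (real_metric_sym (d l)) => rp.
have crp : c * r p <= c * r (d l) + c * (mdist p (d l) / 4).
  by rewrite -mulrDr ler_pM2l.
have : c * (mdist p (d l) / 4) <= mdist p (d l) / 4.
  by rewrite ler_piMl// divr_ge0// mdist_ge0.
have := mdist_ge0 p (d l).
by move: crp lp; move: (c * _) (c * r p) (c * (_ / _)) => a b s; lra.
Qed.

Lemma compact_finite_subcover (K : set M) (s : nat -> R) : compact K ->
  (forall p, K p -> exists l, mdist (d l) p < s l) ->
  exists n, forall p, K p -> exists2 l, (l < n)%N & mdist (d l) p < s l.
Proof.
move=> /compact_near_coveringP cK Ks.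
have [|n _ /(_ n (leqnn n)) nK] := cK nat \oo (fun n p =>
    exists2 l, (l < n)%N & mdist (d l) p < s l) _ _; last by exists n.
move=> p /Ks[l lp]; exists ([set q | mdist (d l) q < s l], [set n | (l < n)%N]).
  split; last by exists l.+1.
  by apply: open_nbhs_nbhs; split => //; exact: open_mdist.
by move=> [q n] [/= lq ln]; exists l.
Qed.

Lemma compact_relcompact K : compact K -> relcompact K.
Proof.
move=> cK; apply: (compact_finite_subcover cK) => p _.
by have [l] := pts_rad p ltr01 (lexx 1); rewrite mul1r; exists l.
Qed.

Lemma relcompact_ball p : relcompact [set q | mdist p q < 3 * r p].
Proof.
have [K cK pK] := crad_compact F p.
exact: relcompact_sub pK (compact_relcompact cK).
Qed.

Lemma relcompact_thicken A : relcompact A ->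
  relcompact [set q | exists2 p, A p & mdist p q < r p].
Proof.
move=> [n nA]; apply: (@relcompact_sub _
    (\bigcup_(l < n) [set q | mdist (d l) q < 3 * r (d l)])); last first.
  by apply: relcompact_bigcup => l; exact: relcompact_ball.
move=> q [p /nA[l ln lp] pq]; exists l => //=.
rewrite (le_lt_trans (real_metric_triangle _ p _))//.
have := crad_lip F p (d l); rewrite (real_metric_sym p (d l)).
have := crad_gt0 F (d l).
by move: lp pq; lra.
Qed.

Lemma relcompact_sub_compact A : relcompact A ->
  exists2 K, compact K & A `<=` K.
Proof.
move=> [n]; elim: n A => [|n ih] A nA.
  by exists set0; [exact: compact0|move=> p /nA[]].
have [K cK dK] := crad_compact F (d n).
have [|K' cK' AK'] := ih (A `\` K).
  move=> p [/nA[l + lp] nKp]; rewrite ltnS leq_eqVlt => /predU1P[ln|]; last by exists l.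
  case: nKp; apply: dK => /=; rewrite -ln (lt_trans lp)//.
  by have := crad_gt0 F (d l); lra.
exists (K `|` K'); first exact: compactU.
by move=> p Ap; have [|nKp] := pselect (K p); [left|right; exact: AK'].
Qed.

Lemma relcompact_net A (e : R) : relcompact A -> 0 < e ->
  exists n, forall p, A p -> exists2 l, (l < n)%N & mdist (d l) p < e.
Proof.
move=> /relcompact_sub_compact[K cK AK] e0.
have [|n nK] := @compact_finite_subcover K (fun=> e) cK; last first.
  by exists n => p /AK/nK.
by move=> p _; have [l lp] := pts_dense F p e0; exists l; rewrite real_metric_sym.
Qed.

(** Ultrafilters do the work of extracting convergent subsequences for all
    points of M at once. *)
Lemma ultra_relcompact_cvg T (U : set_system T) (f : T -> M) A :
  UltraFilter U -> relcompact A -> U (f @^-1` A) -> exists p : M, f @ U --> p.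
Proof.
move=> uU /relcompact_sub_compact[K cK AK] UA.
have [|p [_ Up]] := cK (f @ U) _; first by apply: filterS UA => t /AK.
exists p => N pN; have [//|nUN] := in_ultra_setVsetC (f @^-1` N) uU.
by have [q []] := Up (~` N) N nUN pN.
Qed.

(** M need not be complete, but a Cauchy family on which the radius [crad] is
    constant ends up in a relatively compact ball. This applies to evaluations
    at a point, as [crad] is invariant under isometries. *)
Lemma cauchy_relcompact_cvg T (U : set_system T) (f : T -> M) (s : R) :
  ProperFilter U -> (forall t, r (f t) = s) ->
  (forall e : R, 0 < e ->
     exists2 V, U V & forall t t', V t -> V t' -> mdist (f t) (f t') < e) ->
  exists p : M, f @ U --> p.
Proof.
move=> pU rs cauU; have [t0 _] := filter_ex (@filterT _ U _).
have s0 : 0 < s by rewrite -(rs t0) crad_gt0.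
have [V UV Vs] := cauU s s0; have [t Vt] := filter_ex UV.
have [K cK tK] := crad_compact F (f t).
have VK t' : V t' -> K (f t').
  by move=> Vt'; apply: tK => /=; rewrite rs; have := Vs _ _ Vt Vt'; lra.
have [|p [_ Up]] := cK (f @ U) _.
  exact: (@filterS T U _ V (f @^-1` K) VK UV).
exists p => N /nbhs_mdist[e e0 eN].
have [|W UW We] := cauU (e / 2); first by rewrite divr_gt0.
have [||q [[t1 Wt1 <-] pq]] := Up (f @` W) [set q | mdist p q < e / 2].
- by apply: (@filterS T U _ W (f @^-1` (f @` W)) _ UW) => t1 Wt1; exists t1.
- by apply: open_nbhs_nbhs; split; [exact: open_mdist|rewrite /= mdistxx divr_gt0].
apply: (@filterS T U _ W (f @^-1` N) _ UW) => t2 Wt2; apply: eN.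
rewrite (le_lt_trans (real_metric_triangle _ (f t1) _))//.
by move: (We _ _ Wt1 Wt2) pq; rewrite /=; lra.
Qed.

End relative_compactness.

(** * The isometry group *)

Lemma filter_forall_lt T (F : set_system T) {FF : Filter F} (P : nat -> set T) n :
  (forall s, F (P s)) -> F [set t | forall s, (s < n)%N -> P s t].
Proof.
move=> FP; elim: n => [|n ih]; first by apply: filterS filterT => t _ s.
apply: filterS (filterI ih (FP n)) => t [Pt Pn] s.
by rewrite ltnS leq_eqVlt => /predU1P[->|/Pt].
Qed.

Section isometries.
Context {R : realType} {M : metricType R} (F : frame M).
Local Notation G := (isometryGroup M).
Implicit Types (g h k : G) (p q b : M).
Local Notation d := (pts F).
Local Notation r := (crad F).

Lemma isoM g h p : (g * h)%g p = g (h p). Proof. by []. Qed.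

Lemma isoVK g p : (g^-1)%g (g p) = p. Proof. exact: isometry_funK. Qed.

Lemma isoKV g p : g ((g^-1)%g p) = p. Proof. exact: isometry_inv_funK. Qed.

Lemma mdist_isometryVM g h p q :
  mdist ((g^-1 * h)%g p) q = mdist (g q) (h p).
Proof. by rewrite -(isometry_dist g) isoM isoKV metric_sym. Qed.

Lemma open_isometry_eval q p (e : R) : open [set h : G | mdist q (h p) < e].
Proof.
rewrite openE => g /= qg; have e0 : 0 < e - mdist q (g p) by rewrite subr_gt0.
apply: filterS (isometry_eval_cvg g p e0) => h /= gh.
by have := real_metric_triangle q (g p) (h p); lra.
Qed.

Lemma isometryV_eval_cvg g p (e : R) : 0 < e ->
  nbhs g [set h : G | mdist ((g^-1)%g p) ((h^-1)%g p) < e].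
Proof.
move=> e0; apply: filterS (isometry_eval_cvg g ((g^-1)%g p) e0) => h /=.
by rewrite isoKV -(isometry_dist (h^-1)%g) isoVK real_metric_sym.
Qed.

Lemma mdist_isometry_split g h p q (e : R) : mdist p q < e / 3 ->
  mdist (g q) (h q) < e / 3 -> mdist (g p) (h p) < e.
Proof.
move=> pq ghq; have := real_metric_triangle (g p) (g q) (h p).
have := real_metric_triangle (g q) (h q) (h p).
by rewrite !isometry_dist (real_metric_sym q); move: pq ghq; lra.
Qed.

Lemma nbhs_isometry_basis g (A : set G) : nbhs g A ->
  exists n, forall h, (forall s, (s < n)%N ->
    mdist (g (d s)) (h (d s)) < n.+1%:R^-1) -> A h.
Proof.
pose B n := [set h : G | forall s, (s < n)%N ->
    mdist (g (d s)) (h (d s)) < n.+1%:R^-1].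
have BP m n : (m <= n)%N -> B n `<=` B m.
  move=> mn h Bh s sm; apply: lt_le_trans (Bh s (leq_trans sm mn)) _.
  by rewrite lef_pV2 ?posrE// ler_nat.
suff : filter_from [set: nat] B --> g.
  by move=> Bg /Bg[n _ BA]; exists n => h Bh; exact: BA.
have FB : Filter (filter_from [set: nat] B).
  apply: filter_from_filter; first by exists 0%N.
  move=> m n _ _; exists (maxn m n) => // h Bh.
  by split; apply: BP Bh; rewrite ?leq_maxl ?leq_maxr.
apply/isometry_cvgP => p; apply/cvg_ballP => e e0.
have e30 : 0 < e / 3 by rewrite divr_gt0.
have [s ps] := pts_dense F p e30; have [n ne] := exists_invS e30.
exists (maxn s.+1 n) => // h Bh; rewrite ballEmdist /=.
have ghs : mdist (g (d s)) (h (d s)) < e / 3.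
  apply: le_lt_trans (ltW (Bh s (leq_maxl _ _))) (le_lt_trans _ ne).
  by rewrite lef_pV2 ?posrE// ler_nat ltnS leq_maxr.
exact: (mdist_isometry_split ps ghs).
Qed.

(** The pointwise limits of g and of g^-1 are isometries inverse to each other,
    so the former is surjective. *)
Lemma isometry_cvg (U : set_system G) : ProperFilter U ->
  (forall p, exists q : M, (fun g : G => g p) @ U --> q) ->
  (forall p, exists q : M, (fun g : G => (g^-1)%g p) @ U --> q) ->
  exists g : G, U --> g.
Proof.
move=> pU /choice[f Uf] /choice[f' Uf'].
have near_f p (e : R) : 0 < e -> U [set g : G | mdist (f p) (g p) < e].
  move=> e0; apply: (Uf p [set q | mdist (f p) q < e]); apply: open_nbhs_nbhs.
  by split; [exact: open_mdist|rewrite /= mdistxx].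
have near_f' p (e : R) : 0 < e -> U [set g : G | mdist (f' p) ((g^-1)%g p) < e].
  move=> e0; apply: (Uf' p [set q | mdist (f' p) q < e]); apply: open_nbhs_nbhs.
  by split; [exact: open_mdist|rewrite /= mdistxx].
have f_dist p q : mdist (f p) (f q) = mdist p q.
  apply/eqP; rewrite eq_le; apply/andP; split; apply/ler_addgt0Pl => /= e e0;
    have e20 : 0 < e / 2 by rewrite divr_gt0.
  - have [g [/= gp gq]] := filter_ex (filterI (near_f p _ e20) (near_f q _ e20)).
    have := real_metric_triangle (f p) (g p) (f q).
    have := real_metric_triangle (g p) (g q) (f q).
    by rewrite (real_metric_sym (g q)) isometry_dist; move: gp gq; lra.
  - have [g [/= gp gq]] := filter_ex (filterI (near_f p _ e20) (near_f q _ e20)).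
    have := real_metric_triangle (g p) (f p) (g q).
    have := real_metric_triangle (f p) (f q) (g q).
    by rewrite (real_metric_sym (g p) (f p)) isometry_dist; move: gp gq; lra.
have f_surj p : exists q, f q = p.
  exists (f' p); apply: (@mdist_positivity R); apply/eqP.
  rewrite eq_le mdist_ge0 andbT; apply/ler_addgt0Pl => /= e e0; rewrite addr0.
  have e20 : 0 < e / 2 by rewrite divr_gt0.
  have [g [/= gp gq]] := filter_ex (filterI (near_f' p _ e20) (near_f (f' p) _ e20)).
  have := real_metric_triangle (f (f' p)) (g (f' p)) p.
  by move: gp; rewrite -(isometry_dist g) isoKV; move: gq; lra.
by exists (Isometry f_dist f_surj); apply/isometry_cvgP.
Qed.

(** Inverses are controlled too: a pointwise limit of isometries need not be
    surjective. *)
Definition isometry_small n (V : set G) := forall g h, V g -> V h ->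
  forall s, (s < n)%N -> mdist (g (d s)) (h (d s)) < n.+1%:R^-1 :> R /\
    mdist ((g^-1)%g (d s)) ((h^-1)%g (d s)) < n.+1%:R^-1 :> R.

Lemma isometry_complete_gauge : @complete_gauge G isometry_small.
Proof.
split=> [n g U /nbhs_isometry_basis[m mU]|U pU smallU]; last first.
  have small_eval p (e : R) : 0 < e -> exists2 V, U V & forall g h, V g -> V h ->
      mdist (g p) (h p) < e /\ mdist ((g^-1)%g p) ((h^-1)%g p) < e.
    move=> e0; have e30 : 0 < e / 3 by rewrite divr_gt0.
    have [s ps] := pts_dense F p e30; have [n ne] := exists_invS e30.
    have [V UV sV] := smallU (maxn s.+1 n); exists V => // g h Vg Vh.
    have [lt1 lt2] := sV g h Vg Vh s (leq_maxl _ _).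
    have le3 : (maxn s.+1 n).+1%:R^-1 <= e / 3.
      by rewrite (le_trans _ (ltW ne))// lef_pV2 ?posrE// ler_nat ltnS leq_maxr.
    split; first exact: (mdist_isometry_split ps (lt_le_trans lt1 le3)).
    exact: (mdist_isometry_split ps (lt_le_trans lt2 le3)).
  apply: isometry_cvg => p.
    apply: (@cauchy_relcompact_cvg R M F G U (fun g => g p) (r p)).
    - by move=> g; rewrite crad_isometry.
    - by move=> e /(small_eval p)[V UV Ve]; exists V => // g h Vg /(Ve g h Vg)[].
  apply: (@cauchy_relcompact_cvg R M F G U (fun g => (g^-1)%g p) (r p)).
  - by move=> g; rewrite crad_isometry.
  - by move=> e /(small_eval p)[V UV Ve]; exists V => // g h Vg /(Ve g h Vg)[].
pose e : R := (maxn m n).+1%:R^-1 / 2.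
have e0 : 0 < e by rewrite divr_gt0.
pose N := [set h : G | forall s, (s < maxn m n)%N -> mdist (g (d s)) (h (d s)) < e /\
    mdist ((g^-1)%g (d s)) ((h^-1)%g (d s)) < e].
have gN : nbhs g N.
  apply: filter_forall_lt => s; apply: filterI.
    exact: isometry_eval_cvg.
  exact: isometryV_eval_cvg.
have e2 i : (i <= maxn m n)%N -> e + e <= i.+1%:R^-1.
  by move=> im; rewrite -splitr lef_pV2 ?posrE// ler_nat.
exists N^°; split.
- exact: open_interior.
- by apply: nbhs_singleton; exact: nbhs_interior.
- move=> h cNh; apply: mU => s sm; apply: lt_le_trans (e2 m (leq_maxl _ _)).
  have [k [/interior_subset Nk /= hk]] := cNh _ (isometry_eval_cvg h (d s) e0).
  have [gk _] := Nk s (leq_trans sm (leq_maxl _ _)).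
  rewrite (le_lt_trans (real_metric_triangle _ (k (d s)) _))//.
  by rewrite (real_metric_sym (k _)) ltrD.
- move=> h k /interior_subset Nh /interior_subset Nk s sn.
  have [h1 h2] := Nh s (leq_trans sn (leq_maxr _ _)).
  have [k1 k2] := Nk s (leq_trans sn (leq_maxr _ _)).
  have en := e2 n (leq_maxr _ _).
  split; apply: lt_le_trans en.
    rewrite (le_lt_trans (real_metric_triangle _ (g (d s)) _))//.
    by rewrite (real_metric_sym (h _)) ltrD.
  rewrite (le_lt_trans (real_metric_triangle _ ((g^-1)%g (d s)) _))//.
  by rewrite (real_metric_sym ((h^-1)%g _)) ltrD.
Qed.

(** These sets form a basis of neighbourhoods of 1. *)
Definition nearly_fixing n (e : R) := [set g : G | forall s, (s < n)%N ->
  mdist (g (d s)) (d s) < e].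

Definition spread n (e : R) b := [set g b | g in nearly_fixing n e].

Lemma relcompact_image g (A : set M) : relcompact F A -> relcompact F (g @` A).
Proof.
move=> /relcompact_sub_compact[K cK AK].
apply: (@relcompact_sub _ _ _ _ (g @` K)); first exact: image_subset.
apply: compact_relcompact; apply: continuous_compact => //.
by apply: continuous_subspaceT; exact: isometry_continuous.
Qed.

(** Arzela-Ascoli: if W = [nearly_fixing n e] moves every point within a
    relatively compact set, then ultrafilters on g W converge at every point,
    and so do their inverses because W is closed under inverses. *)
Lemma relcompact_spread_locally_compact n (e : R) : 0 < e ->
  (forall b, relcompact F (spread n e b)) -> locally_compact [set: G].
Proof.
move=> e0 relW g _.
pose V := [set h : G | forall s, (s < n)%N -> mdist (g (d s)) (h (d s)) <= e / 2].
have gV : nbhs g V.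
  have gs s : nbhs g [set h : G | mdist (g (d s)) (h (d s)) < e / 2].
    by apply: isometry_eval_cvg; rewrite divr_gt0.
  by apply: filterS (@filter_forall_lt _ _ _ _ n gs) => h Vh s /Vh/ltW.
have VW h : V h -> nearly_fixing n e (g^-1 * h)%g.
  move=> Vh s /Vh; rewrite mdist_isometryVM.
  by move=> /le_lt_trans; apply; rewrite ltr_pdivrMr// ltr_pMr// ltr1n.
exists V; first by rewrite withinET.
split; last first.
  move=> h cVh s sn; apply/ler_addgt0Pl => /= eps eps0.
  have [k [Vk /= hk]] := cVh _ (isometry_eval_cvg h (d s) eps0).
  have := real_metric_triangle (g (d s)) (k (d s)) (h (d s)).
  by rewrite (real_metric_sym (k _)); have := Vk s sn; move: hk; lra.
rewrite compact_ultra => U uU UV.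
have [||h Uh] := @isometry_cvg U _.
- move=> p; apply: (@ultra_relcompact_cvg R M F G U (fun h => h p) (g @` spread n e p)).
    exact: relcompact_image.
  apply: filterS UV => h /VW Wh; exists ((g^-1)%g (h p)); last exact: isoKV.
  by exists (g^-1 * h)%g.
- move=> p; apply: (@ultra_relcompact_cvg R M F G U (fun h => (h^-1)%g p)
    (spread n e ((g^-1)%g p))) => //.
  apply: filterS UV => h /VW Wh; exists (h^-1 * g)%g.
    move=> s /Wh; rewrite -(isometry_dist (h^-1 * g)%g) !isoM isoKV isoVK.
    by rewrite real_metric_sym.
  by rewrite isoM isoKV.
- exists h; split=> // s sn; apply/ler_addgt0Pl => /= eps eps0.
  have [k [/= Vk hk]] := filter_ex (filterI UV (Uh _ (isometry_eval_cvg h (d s) eps0))).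
  have := real_metric_triangle (g (d s)) (k (d s)) (h (d s)).
  by rewrite (real_metric_sym (k _)); have := Vk s sn; move: hk; rewrite /=; lra.
Qed.

(** An ultrafilter of nearly fixing isometries along which g b tends to
    infinity. *)
Lemma escaping_ultrafilter n (e : R) b : ~ relcompact F (spread n e b) ->
  exists U : set_system G, [/\ UltraFilter U, U (nearly_fixing n e) &
    forall A, relcompact F A -> U [set g | ~ A (g b)]].
Proof.
move=> escape.
pose B (A : set M) := nearly_fixing n e `&` [set g : G | ~ A (g b)].
have pB : ProperFilter (filter_from (relcompact F) B).
  apply: filter_from_proper; last first.
    move=> A rA; apply: contrapT => nB; apply: escape.
    apply: relcompact_sub rA => _ [g Wg <-]; apply: contrapT => nAg.
    by apply: nB; exists g.
  apply: filter_from_filter; first by exists set0, 0%N.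
  move=> A A' rA rA'; exists (A `|` A'); first exact: relcompactU.
  by move=> g [Wg nAg]; split; split=> // Ag; apply: nAg; [left|right].
have [U [uU BU]] := ultraFilterLemma pB; exists U; split=> //.
  by apply: BU; exists set0; [exists 0%N|move=> g []].
by move=> A rA; apply: BU; exists A => // g [].
Qed.

(** Along an ultrafilter, g c either converges or tends to infinity. *)
Lemma ultra_eval_dichotomy (U : set_system G) c (eta : R) : UltraFilter U ->
  0 < eta ->
  (exists2 V, U V & forall g h, V g -> V h -> mdist (g c) (h c) < eta) \/
  (forall A, relcompact F A -> U [set g | ~ A (g c)]).
Proof.
move=> uU eta0.
have [[A rA UA]|nA] := pselect (exists2 A, relcompact F A & U [set g : G | A (g c)]).
  left; have [p Up] := ultra_relcompact_cvg uU rA UA.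
  exists [set g : G | mdist p (g c) < eta / 2].
    apply: (Up [set q | mdist p q < eta / 2]); apply: open_nbhs_nbhs.
    by split; [exact: open_mdist|rewrite /= mdistxx divr_gt0].
  move=> g h /= pg ph; rewrite (le_lt_trans (real_metric_triangle _ p _))//.
  by rewrite [eta]splitr real_metric_sym ltrD.
right=> A rA; have [UA|//] := in_ultra_setVsetC [set g : G | A (g c)] uU.
by case: nA; exists A.
Qed.

(** Non-compactness depends on the controlled points d_s only, not on the
    precision: the isometries in [nearly_fixing n e] take each d_s into a
    relatively compact ball, so along an ultrafilter that escapes at b they
    agree on the d_s up to delta; two of them then differ by an element of
    [nearly_fixing n delta]. The translation by w makes the statement usable at
    every point of an open set of isometries and not just at its centre. *)
Lemma spread_shrink n (e delta : R) b (w : G) :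
  (forall s, (s < n)%N -> e <= r (d s)) -> 0 < delta ->
  nearly_fixing n e w -> ~ relcompact F (spread n e b) ->
  ~ relcompact F (spread n delta ((w^-1)%g b)).
Proof.
move=> er delta0 Ww /escaping_ultrafilter[U [uU UW escape]] rel.
have UV s : U [set u : G | (s < n)%N -> mdist (u (w (d s))) (d s) < 2 * r (d s)].
  apply: filterS UW => u Wu sn.
  have := real_metric_triangle (u (w (d s))) (u (d s)) (d s); rewrite isometry_dist.
  by have := er s sn; have := Wu s sn; have := Ww s sn; lra.
(* If u nearly fixes the d_s, the points u (w d_s) stay in a relatively compact
   ball, so they converge. *)
have UT s : exists T : set G, U T /\
    ((s < n)%N -> forall g h, T g -> T h -> mdist (g (w (d s))) (h (w (d s))) < delta).
  have [sn|_] := boolP (s < n)%N; last by exists setT; split=> //; exact: filterT.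
  have [[T UT Tlt]|far] := @ultra_eval_dichotomy U (w (d s)) delta uU delta0.
    by exists T; split.
  have [u [/= nu /(_ sn) wu]] :=
    filter_ex (filterI (far _ (relcompact_ball F (d s))) (UV s)).
  by case: nu; rewrite /= real_metric_sym; have := crad_gt0 F (d s); move: wu; lra.
have [T /all_and2[nT Tlt]] := choice UT.
have Tn : U [set t | forall s, (s < n)%N -> T s t] by exact: filter_forall_lt.
have [u Tu] := filter_ex Tn.
(* As v varies, (u w)^-1 (v w) nearly fixes the d_s to precision delta; so v b =
   v w (w^-1 b) stays in A, which is impossible if it escapes. *)
pose A := (u * w)%g @` spread n delta ((w^-1)%g b).
have [v [/= nAv Tv]] := filter_ex (filterI (escape A (relcompact_image _ rel)) Tn).
pose x : G := ((u * w)^-1 * (v * w))%g.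
apply: nAv; exists (x ((w^-1)%g b)); last first.
  exact: etrans (isoKV (u * w)%g _) (congr1 v (isoKV w b)).
exists x => // s sn; rewrite /x mdist_isometryVM; apply: (Tlt s sn); [exact: Tu|exact: Tv].
Qed.

(** Take k = h^-1 g with h, then g, far along an escaping ultrafilter. If g c_s
    converges, g and h nearly agree at c_s; if it tends to infinity, so does
    h^-1 g c_s for fixed h. *)
Lemma exists_escaping n (delta : R) b (A : set M) (c : nat -> M) N (eta : R) :
  ~ relcompact F (spread n delta b) -> relcompact F A -> 0 < eta ->
  exists k, [/\ nearly_fixing n (delta + delta) k, ~ A (k b) &
    forall s, (s < N)%N -> mdist (k (c s)) (c s) < eta \/ ~ A (k (c s))].
Proof.
move=> /escaping_ultrafilter[U [uU UW escape]] rA eta0.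
have UV s : exists V, U V /\ forall h, V h ->
    U [set g : G | mdist (h (c s)) (g (c s)) < eta \/ ~ (h @` A) (g (c s))].
  have [[V UV Veta]|far] := @ultra_eval_dichotomy U (c s) eta uU eta0.
    exists V; split=> // h Vh; apply: filterS UV => g Vg; left; exact: Veta.
  exists setT; split=> [|h _]; first exact: filterT.
  by apply: filterS (far _ (relcompact_image h rA)) => g; right.
have [V /all_and2[nV Vh]] := choice UV.
have [h [/= Wh Vhs]] := filter_ex (filterI UW (@filter_forall_lt _ _ _ _ N nV)).
have near_h s : U [set g : G | (s < N)%N ->
    mdist (h (c s)) (g (c s)) < eta \/ ~ (h @` A) (g (c s))].
  have [sN|_] := boolP (s < N)%N; last by apply: filterS filterT.
  by apply: filterS (Vh s h (Vhs s sN)) => g gh _; exact: gh.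
have [g [/= Wg [ngb gs]]] := filter_ex (filterI UW
  (filterI (escape _ (relcompact_image h rA)) (@filter_forall_lt _ _ _ _ N near_h))).
exists (h^-1 * g)%g; split=> [s sn|Agb|s sN].
- rewrite mdist_isometryVM.
  rewrite (le_lt_trans (real_metric_triangle _ (d s) _))//.
  by rewrite (real_metric_sym (d s)) ltrD// ?Wh ?Wg.
- by apply: ngb; exists ((h^-1 * g)%g b) => //; exact: isoKV.
- have [near_gh|far] := gs s sN sN; first by left; rewrite mdist_isometryVM.
  by right=> Ag; apply: far; exists ((h^-1 * g)%g (c s)) => //; exact: isoKV.
Qed.

End isometries.

(** * The space of Lipschitz sequences and its action *)

Definition radial_lipschitz (R : realType) (M : metricType R) (F : frame M)
    (f : M -> R) :=
  [/\ forall p, 0 <= f p, forall p, f p <= crad F p &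
      forall p q, f p <= f q + mdist p q].

(** Infinitely many coordinates, so that finitely many conditions on x always
    leave a coordinate free. *)
Record lipSeq (R : realType) (M : metricType R) (F : frame M) := LipSeq {
  lip_fun :> nat -> M -> R ;
  lipP : forall i, radial_lipschitz F (lip_fun i)
}.

Section lipschitz_space.
Context {R : realType} {M : metricType R} (F : frame M).
Local Notation G := (isometryGroup M).
Implicit Types (x y z : lipSeq F) (p q : M) (g h : G).
Local Notation d := (pts F).
Local Notation r := (crad F).

(** McShane's formula: the supremum of 0 and of the v - dist(p, -), for (p, v)
    in S. *)
Lemma lipschitz_extension (S : set (M * R)) :
  (forall a, S a -> 0 <= a.2 <= r a.1) ->
  (forall a b, S a -> S b -> a.2 <= b.2 + mdist a.1 b.1) ->
  exists2 f, radial_lipschitz F f & forall a, S a -> f a.1 = a.2.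
Proof.
move=> S_rad S_lip.
pose V p := [set t | t = 0 \/ exists2 a, S a & t = a.2 - mdist a.1 p].
have V_le p t : V p t -> t <= r p.
  move=> [->|[a /S_rad/andP[_ ar] ->]]; first by rewrite ltW// crad_gt0.
  have := crad_lip F a.1 p; have := mdist_ge0 a.1 p; move: ar.
  by lra.
have V0 p : V p 0 by left.
have V_sup p : has_sup (V p) by split; [exists 0|exists (r p) => t /V_le].
exists (fun p => sup (V p)); first split.
- by move=> p; exact: sup_upper_bound (V_sup p) _ (V0 p).
- by move=> p; apply: ge_sup; [exists 0|move=> t /V_le].
- move=> p q; apply: ge_sup; first by exists 0.
  move=> t [->|[a Sa ->]].
    by rewrite addr_ge0 ?mdist_ge0//; exact: sup_upper_bound (V_sup q) _ (V0 q).
  have : a.2 - mdist a.1 q <= sup (V q).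
    by apply: sup_upper_bound (V_sup q) _ _; right; exists a.
  have := real_metric_triangle a.1 p q; lra.
- move=> a Sa; apply/eqP; rewrite eq_le; apply/andP; split; last first.
    apply: sup_upper_bound (V_sup _) _ _; right; exists a => //.
    by rewrite mdistxx subr0.
  apply: ge_sup; first by exists 0.
  move=> t [->|[b Sb ->]]; first by have /andP[] := S_rad a Sa.
  by have := S_lip b a Sb Sa; lra.
Qed.

Lemma lip_ext x y : (forall i p, x i p = y i p) -> x = y.
Proof.
case: x y => [x xP] [y yP] /= xy.
have xyE : x = y by apply/funext => i; apply/funext => p.
by rewrite -xyE in yP *; congr LipSeq; exact: Prop_irrelevance.
Qed.

Lemma lip_sub_le1 x y i p : `|x i p - y i p| <= 1.
Proof.
have [x0 xr _] := lipP x i; have [y0 yr _] := lipP y i.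
have := crad_le1 F p; have := x0 p; have := xr p; have := y0 p; have := yr p.
by rewrite ler_norml; lra.
Qed.

(** The weights tend to 0 and the coordinates are bounded by 1, so that the
    supremum of the gaps metrizes pointwise convergence. *)
Definition lip_gaps x y := [set t | exists i s,
  t = `|x i (d s) - y i (d s)| / (i + s).+1%:R].

Definition lip_dist x y := sup (lip_gaps x y).

Let has_sup_gaps x y : has_sup (lip_gaps x y).
Proof.
split; first by exists (`|x 0%N (d 0%N) - y 0%N (d 0%N)| / 1%:R), 0%N, 0%N.
exists 1 => _ [i [s ->]]; rewrite ler_pdivrMr// mul1r.
by rewrite (le_trans (lip_sub_le1 _ _ _ _))// ler1n.
Qed.

Lemma lip_gap_le x y i s :
  `|x i (d s) - y i (d s)| <= (i + s).+1%:R * lip_dist x y.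
Proof.
rewrite mulrC -ler_pdivrMr//.
by apply: sup_upper_bound (has_sup_gaps x y) _ _; exists i, s.
Qed.

Lemma lip_dist_le x y N : (forall i s, (i < N)%N -> (s < N)%N ->
  `|x i (d s) - y i (d s)| < N.+1%:R^-1) -> lip_dist x y <= N.+1%:R^-1.
Proof.
move=> xy; apply: ge_sup; first by have [] := has_sup_gaps x y.
move=> _ [i [s ->]]; rewrite ler_pdivrMr//.
have N0 : 0 <= N.+1%:R^-1 :> R by rewrite invr_ge0.
have [/andP[iN sN]|] := boolP ((i < N) && (s < N))%N.
  by rewrite (le_trans (ltW (xy i s iN sN)))// ler_peMr// ler1n.
rewrite negb_and -!leqNgt => Nis; apply: le_trans (lip_sub_le1 _ _ _ _) _.
rewrite mulrC ler_pdivlMr// mul1r ler_nat ltnS.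
by case/orP: Nis => /leq_trans; apply; rewrite ?leq_addr ?leq_addl.
Qed.

Let lip_distxx x : lip_dist x x = 0.
Proof.
apply/eqP; rewrite eq_le; apply/andP; split.
  apply: ge_sup; first by have [] := has_sup_gaps x x.
  by move=> _ [i [s ->]]; rewrite subrr normr0 mul0r.
apply: sup_upper_bound (has_sup_gaps x x) _ _; exists 0%N, 0%N.
by rewrite subrr normr0 mul0r.
Qed.

Let lip_dist_sym x y : lip_dist x y = lip_dist y x.
Proof.
congr sup; apply/seteqP; split => t [i [s ->]]; exists i, s;
  by rewrite distrC.
Qed.

Let lip_dist_triangle y x z : lip_dist x z <= lip_dist x y + lip_dist y z.
Proof.
apply: ge_sup; first by have [] := has_sup_gaps x z.
move=> _ [i [s ->]]; rewrite ler_pdivrMr//.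
apply: le_trans (ler_distD (y i (d s)) _ _) _.
by rewrite mulrC mulrDr lerD// lip_gap_le.
Qed.

Let lip_dist_eq x y : lip_dist x y = 0 -> x = y.
Proof.
move=> xy0; apply: lip_ext => i p.
have xyd s : x i (d s) = y i (d s).
  by have := lip_gap_le x y i s; rewrite xy0 mulr0 normr_le0 subr_eq0 => /eqP.
have [_ _ xL] := lipP x i; have [_ _ yL] := lipP y i.
apply/eqP; rewrite eq_le; apply/andP; split; apply/ler_addgt0Pl => /= e e0;
  have e20 : 0 < e / 2 by rewrite divr_gt0.
- have [s ps] := pts_dense F p e20; have := xL p (d s); have := yL (d s) p.
  by rewrite xyd (real_metric_sym (d s)); move: ps; lra.
- have [s ps] := pts_dense F p e20; have := yL p (d s); have := xL (d s) p.
  by rewrite xyd (real_metric_sym (d s)); move: ps; lra.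
Qed.

HB.instance Definition _ := gen_eqMixin (lipSeq F).
HB.instance Definition _ := gen_choiceMixin (lipSeq F).
HB.instance Definition _ :=
  isMetric.Build R (lipSeq F) lip_distxx lip_dist_eq lip_dist_sym lip_dist_triangle.

Lemma radial_lipschitz0 : radial_lipschitz F (fun=> 0).
Proof.
split=> // [p|p q]; first by rewrite ltW// crad_gt0.
by rewrite add0r mdist_ge0.
Qed.

HB.instance Definition _ := isPointed.Build (lipSeq F)
  (LipSeq (fun=> radial_lipschitz0)).

Lemma lip_sub_split x y p q i (e : R) : mdist p q < e / 3 ->
  `|x i q - y i q| < e / 3 -> `|x i p - y i p| < e.
Proof.
move=> pq; have [_ _ xL] := lipP x i; have [_ _ yL] := lipP y i.
have := xL p q; have := xL q p; have := yL p q; have := yL q p.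
rewrite (real_metric_sym q p) !ltr_norml; move: pq; lra.
Qed.

Lemma lip_mdist_eval i p (e : R) : 0 < e ->
  exists2 delta : R, 0 < delta &
    forall x y, mdist x y < delta -> `|x i p - y i p| < e.
Proof.
move=> e0; have e30 : 0 < e / 3 by rewrite divr_gt0.
have [s ps] := pts_dense F p e30; exists (e / 3 / (i + s).+1%:R).
  by rewrite divr_gt0.
move=> x y; rewrite ltr_pdivlMr// => xy; apply: (lip_sub_split ps).
by rewrite (le_lt_trans (lip_gap_le _ _ _ _))// mulrC.
Qed.

Lemma lip_eval_near x i p (e : R) : 0 < e ->
  nbhs x [set y | `|x i p - y i p| < e].
Proof.
move=> /(lip_mdist_eval i p)[delta delta0 xe]; apply/nbhs_mdist.
by exists delta => // y; exact: xe.
Qed.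

Lemma nbhs_lip_basis x (A : set (lipSeq F)) : nbhs x A ->
  exists N, forall y, (forall i s, (i < N)%N -> (s < N)%N ->
    `|x i (d s) - y i (d s)| < N.+1%:R^-1) -> A y.
Proof.
move=> /nbhs_mdist[e e0 eA]; have [N Ne] := exists_invS e0.
by exists N => y /lip_dist_le xy; apply: eA; rewrite (le_lt_trans xy).
Qed.

Lemma lip_complete (U : set_system (lipSeq F)) :
  ProperFilter U -> cauchy U -> cvg U.
Proof.
move=> pU /cauchy_ballP cU.
have /choice[l lP] (ip : nat * M) : exists l : R, forall e : R, 0 < e ->
    U [set x : lipSeq F | `|l - x ip.1 ip.2| < e].
  have pU' : ProperFilter ((fun x : lipSeq F => x ip.1 ip.2) @ U).
    exact: fmap_proper_filter.
  have cU' : @cauchy R ((fun x : lipSeq F => x ip.1 ip.2) @ U).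
    apply: (@cauchy_exP R R) => e e0.
    have [delta delta0 xe] := lip_mdist_eval ip.1 ip.2 e0.
    have [[V W] /= [UV UW] VW] := cU delta delta0.
    have [x [Vx Wx]] := filter_ex (filterI UV UW).
    exists (x ip.1 ip.2); apply: filterS UW => y Wy; apply: xe.
    have : ball x delta y := VW (x, y) (conj Vx Wy).
    by rewrite ballEmdist.
  have /cvg_ex[l Ul] := R_complete pU' cU'.
  by exists l => e e0; move/cvgrPdist_lt: Ul => /(_ e e0).
have l_lip i : radial_lipschitz F (fun p => l (i, p)).
  split=> [p|p|p q]; apply/ler_addgt0Pl => /= e e0.
  - have [x /=] := filter_ex (lP (i, p) e e0); have [x0 _ _] := lipP x i.
    by rewrite ltr_norml; have := x0 p; lra.
  - have [x /=] := filter_ex (lP (i, p) e e0); have [_ xr _] := lipP x i.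
    by rewrite ltr_norml; have := xr p; lra.
  - have e20 : 0 < e / 2 by rewrite divr_gt0.
    have [x /= []] := filter_ex (filterI (lP (i, p) _ e20) (lP (i, q) _ e20)).
    by have [_ _ xL] := lipP x i; rewrite !ltr_norml; have := xL p q; lra.
apply/cvg_ex; exists (LipSeq l_lip) => A /nbhs_lip_basis[N NA].
have N0 : 0 < N.+1%:R^-1 :> R by rewrite invr_gt0.
have UN : U [set x : lipSeq F | forall i, (i < N)%N -> forall s, (s < N)%N ->
    `|l (i, d s) - x i (d s)| < N.+1%:R^-1].
  apply: (filter_forall_lt (P := fun i => [set x : lipSeq F | forall s, (s < N)%N ->
    `|l (i, d s) - x i (d s)| < N.+1%:R^-1])) => i.
  apply: (filter_forall_lt (P := fun s => [set x : lipSeq F |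
    `|l (i, d s) - x i (d s)| < N.+1%:R^-1])) => s.
  exact: lP (i, d s) _ N0.
by apply: filterS UN => x xN; apply: NA => i s iN sN; exact: xN.
Qed.

HB.instance Definition _ := Uniform_isComplete.Build (lipSeq F) lip_complete.

(** A countable basis; k.2 lists a k.1 by k.1 table of approximate values, row
    by row. *)
Definition lip_cell (k : nat * seq rat) := [set x : lipSeq F |
  forall i s, (i < k.1)%N -> (s < k.1)%N ->
    `|x i (d s) - ratr (nth 0 k.2 (i * k.1 + s))| < k.1.+1%:R^-1 / 2].

Lemma lip_cell_open k : open (lip_cell k).
Proof.
rewrite openE => x xk; pose t : R := k.1.+1%:R^-1 / 2.
pose P i s := [set y : lipSeq F | (i < k.1)%N -> (s < k.1)%N ->
  `|y i (d s) - ratr (nth 0 k.2 (i * k.1 + s))| < t].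
have xP i s : nbhs x (P i s).
  have [ik|] := boolP (i < k.1)%N; last first.
    by rewrite /P => /negbTE->; apply: filterS filterT.
  have [sk|] := boolP (s < k.1)%N; last first.
    by rewrite /P => /negbTE->; apply: filterS filterT.
  have es : 0 < t - `|x i (d s) - ratr (nth 0 k.2 (i * k.1 + s))|.
    by rewrite subr_gt0; exact: xk.
  apply: filterS (lip_eval_near x i (d s) es) => y /= xy _ _.
  have := ler_distD (x i (d s)) (y i (d s)) (ratr (nth 0 k.2 (i * k.1 + s))).
  by rewrite (distrC (y i (d s)) (x i (d s))); move: xy; lra.
apply: filterS (@filter_forall_lt _ (nbhs x) _ _ k.1
  (fun i => @filter_forall_lt _ (nbhs x) _ _ k.1 (xP i))).
by move=> y yP i s ik sk; exact: yP.
Qed.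

Lemma lip_cell_near x (A : set (lipSeq F)) : nbhs x A ->
  exists2 k, lip_cell k x & lip_cell k `<=` A.
Proof.
move=> /nbhs_lip_basis[N NA].
have /choice[q qx] (j : nat) : exists q : rat,
    `|x (j %/ N)%N (d (j %% N)%N) - ratr q| < N.+1%:R^-1 / 2 :> R.
  have [|q] := @rat_in_itvoo R (x (j %/ N)%N (d (j %% N)%N) - N.+1%:R^-1 / 2)
      (x (j %/ N)%N (d (j %% N)%N) + N.+1%:R^-1 / 2).
    by rewrite ltrD2l -subr_gt0 opprK addr_gt0// divr_gt0.
  rewrite in_itv /= => /andP[xq qx]; exists q; rewrite ltr_norml.
  by move: xq qx; move: (N.+1%:R^-1 : R) => t; lra.
exists (N, mkseq q (N * N)) => [i s /= iN sN|y /= Ny].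
  have isN : (i * N + s < N * N)%N.
    by apply: leq_trans (leq_mul iN (leqnn N)); rewrite mulSnr ltn_add2l.
  have N0 : (0 < N)%N by case: (N) iN.
  rewrite nth_mkseq//; have := qx (i * N + s)%N.
  by rewrite divnMDl// modnMDl divn_small// modn_small// addn0.
apply: NA => i s iN sN.
have isN : (i * N + s < N * N)%N.
  by apply: leq_trans (leq_mul iN (leqnn N)); rewrite mulSnr ltn_add2l.
have N0 : (0 < N)%N by case: (N) iN.
have := Ny i s iN sN; rewrite nth_mkseq//; have := qx (i * N + s)%N.
rewrite divnMDl// modnMDl divn_small// modn_small// addn0 !ltr_norml.
by move: (N.+1%:R^-1 : R) => t; lra.
Qed.

Lemma lip_separable : separable_space (lipSeq F).
Proof.
exists (range (fun k : nat * seq rat => get (lip_cell k))).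
  by apply: card_le_trans (card_image_le _ _) _; exact: countableP.
move=> A [x Ax] oA.
have [k kx kA] := lip_cell_near (open_nbhs_nbhs (conj oA Ax)).
have ky : lip_cell k (get (lip_cell k)) by apply: getPex; exists x.
by exists (get (lip_cell k)); split; [exact: kA|exists k].
Qed.

Lemma lip_move_subproof g x i :
  radial_lipschitz F (fun p => x i ((g^-1)%g p)).
Proof.
have [x0 xr xL] := lipP x i; split=> [p|p|p q]; first exact: x0.
  by rewrite -(crad_isometry F (g^-1)%g) xr.
by rewrite -(isometry_dist (g^-1)%g p q); exact: xL.
Qed.

Definition lip_move g x := LipSeq (lip_move_subproof g x).

Lemma lip_moveE g x i p : lip_move g x i p = x i ((g^-1)%g p). Proof. by []. Qed.

Lemma lip_move1 x : lip_move 1%g x = x.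
Proof. by apply: lip_ext => i p; congr (x i _); exact: (isoKV 1%g p). Qed.

Lemma lip_moveM g h x : lip_move (g * h)%g x = lip_move g (lip_move h x).
Proof.
apply: lip_ext => i p; rewrite !lip_moveE; congr (x i _).
apply: (@isometry_inj R M (g * h)%g); rewrite isoKV isoM.
by rewrite !isoKV.
Qed.

(** Joint continuity of the action; by the Lipschitz condition, moving g^-1 d_s
    slightly hardly changes the value there. *)
Lemma lip_move_near g x (A : set (lipSeq F)) : nbhs (lip_move g x) A ->
  exists U V, [/\ nbhs g U, nbhs x V &
    forall h y, U h -> V y -> A (lip_move h y)].
Proof.
move=> /nbhs_lip_basis[N NA]; pose e : R := N.+1%:R^-1 / 2.
have e0 : 0 < e by rewrite divr_gt0.
exists [set h : G | forall s, (s < N)%N ->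
    mdist ((g^-1)%g (d s)) ((h^-1)%g (d s)) < e].
exists [set y : lipSeq F | forall i, (i < N)%N -> forall s, (s < N)%N ->
    `|x i ((g^-1)%g (d s)) - y i ((g^-1)%g (d s))| < e]; split.
- apply: (filter_forall_lt (P := fun s => [set h : G |
    mdist ((g^-1)%g (d s)) ((h^-1)%g (d s)) < e])) => s.
  exact: isometryV_eval_cvg.
- apply: (filter_forall_lt (P := fun i => [set y : lipSeq F |
    forall s, (s < N)%N ->
    `|x i ((g^-1)%g (d s)) - y i ((g^-1)%g (d s))| < e])) => i.
  apply: (filter_forall_lt (P := fun s => [set y : lipSeq F |
    `|x i ((g^-1)%g (d s)) - y i ((g^-1)%g (d s))| < e])) => s.
  exact: lip_eval_near.
- move=> h y gh xy; apply: NA => i s iN sN; rewrite !lip_moveE.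
  have [_ _ yL] := lipP y i.
  have := yL ((g^-1)%g (d s)) ((h^-1)%g (d s)).
  have := yL ((h^-1)%g (d s)) ((g^-1)%g (d s)).
  have := gh s sN; have := xy i iN s sN.
  rewrite (real_metric_sym ((h^-1)%g (d s))) !ltr_norml /e.
  by move: (N.+1%:R^-1 : R) => t; lra.
Qed.

Lemma lip_move_continuous_lip g (A : set (lipSeq F)) :
  open A -> open (lip_move g @^-1` A).
Proof.
rewrite !openE => oA x Ax.
have [U [V [gU xV UV]]] := lip_move_near (oA _ Ax).
by apply: filterS xV => y; apply: UV; exact: nbhs_singleton.
Qed.

Lemma lip_move_continuous_iso x (A : set (lipSeq F)) :
  open A -> open [set g : G | A (lip_move g x)].
Proof.
rewrite !openE => oA g Ax.
have [U [V [gU xV UV]]] := lip_move_near (oA _ Ax).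
by apply: filterS gU => h Uh; apply: UV => //; exact: nbhs_singleton.
Qed.

Definition isometry_cell (k : nat * seq nat) := [set g : G | forall s,
  (s < k.1)%N -> mdist (d (nth 0%N k.2 s)) (g (d s)) < k.1.+1%:R^-1 / 2]°.

Lemma isometry_cell_near g (A : set G) : nbhs g A ->
  exists2 k, isometry_cell k g & isometry_cell k `<=` A.
Proof.
move=> /(nbhs_isometry_basis F)[N NA].
have e0 : 0 < N.+1%:R^-1 / 2 :> R by rewrite divr_gt0.
have /choice[q gq] (s : nat) : exists n, mdist (g (d s)) (d n) < N.+1%:R^-1 / 2 :> R.
  exact: pts_dense.
have gN : nbhs g [set h : G | forall s, (s < N)%N ->
    mdist (d (q s)) (h (d s)) < N.+1%:R^-1 / 2].
  apply: (filter_forall_lt (P := fun s => [set h : G |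
    mdist (d (q s)) (h (d s)) < N.+1%:R^-1 / 2])) => s.
  apply: open_nbhs_nbhs; split; first exact: open_isometry_eval.
  by rewrite /= real_metric_sym.
exists (N, mkseq q N) => [|h /interior_subset /= Nh].
  by apply: filterS gN => h Nh s sN; rewrite nth_mkseq//; exact: Nh.
apply: NA => s sN; have := Nh s sN; rewrite nth_mkseq//.
have := real_metric_triangle (g (d s)) (d (q s)) (h (d s)).
by have := gq s; move: (N.+1%:R^-1 : R) => t; lra.
Qed.

End lipschitz_space.

Section borel_action.
Context {R : realType} {M : metricType R} (F : frame M).
Local Notation G := (isometryGroup M).

(** Preimages of open sets are countable unions of products of basic open sets,
    and therefore are measurable for the product of the Borel sigma-algebras. *)
Lemma lip_move_measurable : measurable_fun [set: borel G * borel (lipSeq F)]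
  (fun a => lip_move a.1 a.2 : borel (lipSeq F)).
Proof.
apply: (@measurability _ _ (borel G * borel (lipSeq F))%type (borel (lipSeq F))
  setT _ (@open (lipSeq F)) erefl) => _ [A oA <-].
rewrite setTI.
pose J : countType := ((nat * seq nat) * (nat * seq rat))%type.
pose B (j : J) : set (borel G * borel (lipSeq F)) :=
  isometry_cell F j.1 `*` lip_cell j.2.
pose P (a : G * lipSeq F) := A (lip_move a.1 a.2).
rewrite (_ : _ @^-1` _ = \bigcup_(j in [set j : J | B j `<=` P]) B j).
  rewrite bigcup_mkcond; apply: countable_bigcupT_measurable => // j.
  case: ifP => _ //; apply: measurableX.
    by apply: sub_sigma_algebra; exact: open_interior.
  by apply: sub_sigma_algebra; exact: lip_cell_open.
apply/seteqP; split=> [[g x] /= Agx|[g x] [j jP jgx]]; last exact: (jP (g, x)).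
have [U [V [gU xV UV]]] := lip_move_near (open_nbhs_nbhs (conj oA Agx)).
have [k kg kU] := isometry_cell_near F gU.
have [l lx lV] := lip_cell_near xV.
exists (k, l) => // -[h y] [/= /kU Uh /lV Vy]; exact: UV.
Qed.

Lemma lip_borel_action : borel_action (fun g (x : borel (lipSeq F)) => lip_move g x).
Proof.
split; [exact: lip_move1|exact: lip_moveM|exact: lip_move_measurable].
Qed.

Lemma lip_standard_borel : standard_borel R (borel (lipSeq F)).
Proof.
exists (lipSeq F), id; split.
- exact: lip_separable.
- by exists id.
- by move=> A; rewrite image_id.
Qed.
End borel_action.

(** * Generic Lipschitz sequences *)

Section generic_points.
Context {R : realType} {M : metricType R} (F : frame M).
Local Notation G := (isometryGroup M).
Implicit Types (x y z : lipSeq F) (p q b : M) (g h k : G).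
Local Notation d := (pts F).
Local Notation r := (crad F).

Lemma relcompact_unit_ball p : relcompact F [set q | mdist p q < r p].
Proof.
apply: relcompact_sub (relcompact_ball F p) => q /= pq.
by have := crad_gt0 F p; lra.
Qed.

(** Keep x0 on the d_s and copy the value from d_s to k d_s whenever k d_s is
    far away; at the remaining d_s, which k hardly moves, the Lipschitz
    condition suffices. Coordinate N is free and takes a bump at k d_l that
    vanishes on the ball around d_j. *)
Lemma escaping_extension x0 N n (delta eta : R) l j :
  ~ relcompact F (spread F n delta (d l)) -> 0 < eta ->
  exists x k, [/\ nearly_fixing F n (delta + delta) k,
    forall i s, (i < N)%N -> (s < N)%N -> x i (d s) = x0 i (d s),
    forall i s, (i < N)%N -> (s < N)%N -> `|x i (k (d s)) - x i (d s)| < eta,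
    forall q, mdist (d j) q < r (d j) -> x N q = 0 &
    x N (k (d l)) = r (d l)].
Proof.
move=> escape eta0.
pose A := (\bigcup_(s < N) [set q | mdist (d s) q < 3 * r (d s)]) `|`
  [set q | mdist (d j) q < 3 * r (d j)].
have rA : relcompact F A.
  apply: relcompactU (relcompact_ball F (d j)).
  by apply: relcompact_bigcup => s; exact: relcompact_ball.
have [k [Wk nAkl kd]] := exists_escaping d N escape rA eta0.
(* Outside A, the bound by crad alone makes values compatible with those of x0
   at the d_s. *)
have farN s p : (s < N)%N -> ~ A p -> 3 * r (d s) <= mdist (d s) p.
  by move=> sN nAp; rewrite leNgt; apply/negP => sp; apply: nAp; left; exists s.
have [fN [fN0 fNr fNL] fNS] : exists2 f, radial_lipschitz F f &
    forall a, (a = (k (d l), r (d l)) \/ (mdist (d j) a.1 < r (d j) /\ a.2 = 0)) ->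
    f a.1 = a.2.
  have kl : 3 * r (d j) <= mdist (d j) (k (d l)).
    by rewrite leNgt; apply/negP => jkl; apply: nAkl; right.
  apply: lipschitz_extension => [[p v] /=|[p v] [q w] /=].
    move=> [[-> ->]|[_ ->]]; last by rewrite lexx ltW// crad_gt0.
    by rewrite crad_isometry lexx ltW// crad_gt0.
  move=> [[-> ->]|[jp ->]] [[-> ->]|[jq ->]]; rewrite ?add0r ?mdist_ge0//.
  - by rewrite lerDl mdist_ge0.
  - have := crad_lip F (k (d l)) (d j); rewrite crad_isometry.
    have := real_metric_triangle (d j) q (k (d l)).
    rewrite (real_metric_sym q) (real_metric_sym (k (d l)) (d j)).
    by move: kl jq; have := crad_gt0 F (d j); lra.
  - by rewrite addr_ge0 ?mdist_ge0// ltW// crad_gt0.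
have /choice[f fP] (i : nat) : exists f : M -> R, radial_lipschitz F f /\
    forall s, (s < N)%N -> f (d s) = x0 i (d s) /\
      (~ A (k (d s)) -> f (k (d s)) = x0 i (d s)).
  have [x0_ge0 x0r x0L] := lipP x0 i.
  pose S : set (M * R) := [set a | exists2 s, (s < N)%N &
    a = (d s, x0 i (d s)) \/ (~ A (k (d s)) /\ a = (k (d s), x0 i (d s)))].
  have [||f fL fS] := @lipschitz_extension R M F S.
  - by move=> a [s sN [->|[_ ->]]] /=; rewrite ?crad_isometry x0_ge0 x0r.
  - move=> a b [s sN [->|[nAs ->]]] [t tN [->|[nAt ->]]] /=.
    + exact: x0L.
    + have := farN s _ sN nAt; have := x0r (d s); have := x0_ge0 (d t).
      by have := crad_gt0 F (d s); lra.
    + have := farN t _ tN nAs; have := x0r (d s); have := x0_ge0 (d t).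
      have := crad_lip F (k (d s)) (d t); rewrite crad_isometry.
      rewrite (real_metric_sym (d t)).
      by have := mdist_ge0 (k (d s)) (d t); lra.
    + by rewrite isometry_dist.
  - exists f; split=> // s sN; split.
      by apply: (fS (d s, x0 i (d s))); exists s => //; left.
    by move=> nAs; apply: (fS (k (d s), x0 i (d s))); exists s => //; right.
have xL i : radial_lipschitz F (if (i < N)%N then f i else fN).
  by case: ifP => _; [exact: (fP i).1|split].
exists (LipSeq xL), k; split=> //=.
- by move=> i s iN sN; rewrite iN; exact: ((fP i).2 s sN).1.
- move=> i s iN sN; rewrite iN; have [fL fs] := fP i.
  have [near_k|nAs] := kd s sN; last first.
    by have [-> /(_ nAs)->] := fs s sN; rewrite subrr normr0.
  have [_ _ L] := fL; have := L (k (d s)) (d s); have := L (d s) (k (d s)).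
  by rewrite (real_metric_sym (d s)) ltr_norml; move: near_k; lra.
- by move=> q jq; rewrite ltnn; apply: (fNS (q, 0)); right.
- by rewrite ltnn; apply: (fNS (k (d l), r (d l))); left.
Qed.

(** k^-1 x is close to x, but the value that it takes at d_l exceeds some x_i on
    the j-th ball by a margin, so that d_l can later be replaced by a nearby
    point. *)
Definition wandering n N l j := [set x : lipSeq F | exists k,
  [/\ nearly_fixing F n (N.+1%:R^-1) k,
    forall i s, (i < N)%N -> (s < N)%N ->
      `|x i (k (d s)) - x i (d s)| < N.+1%:R^-1 &
    exists i, forall q, mdist (d j) q < r (d j) ->
      x i q + r (d l) / 2 < x i (k (d l))]].

(** The conditions on the x of [escaping_extension] are open: finitely many of
    them are strict inequalities at points, and the one on a ball is controlled
    by a finite net. *)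
Lemma wandering_dense n N l j (A : set (lipSeq F)) : open A -> A !=set0 ->
  ~ relcompact F (spread F n (N.+1%:R^-1 / 2) (d l)) ->
  exists x, A x /\ (wandering n N l j)° x.
Proof.
move=> oA [x0 Ax0] escape.
have [N0 N0A] := nbhs_lip_basis (open_nbhs_nbhs (conj oA Ax0)).
pose t : R := N.+1%:R^-1; have t0 : 0 < t by rewrite invr_gt0.
have [x [k [Wk xx0 xk xN0 xNk]]] :=
  @escaping_extension x0 (maxn N0 N) n (t / 2) t l j escape t0.
exists x; split.
  apply: N0A => i s iN sN; rewrite xx0 ?leq_max ?iN ?sN//.
  by rewrite subrr normr0 invr_gt0.
pose m := maxn N0 N; pose e := r (d l) / 8.
have e0 : 0 < e by rewrite divr_gt0// crad_gt0.
have [c jc] := relcompact_net (relcompact_unit_ball (d j)) e0.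
pose P i s := [set y : lipSeq F | (i < N)%N -> (s < N)%N ->
  `|y i (k (d s)) - y i (d s)| < t].
have xP i s : nbhs x (P i s).
  have [iN|] := boolP (i < N)%N; last first.
    by rewrite /P => /negbTE->; apply: filterS filterT.
  have [sN|] := boolP (s < N)%N; last first.
    by rewrite /P => /negbTE->; apply: filterS filterT.
  have es : 0 < (t - `|x i (k (d s)) - x i (d s)|) / 2.
    by rewrite divr_gt0// subr_gt0; apply: xk; rewrite leq_max ?iN ?sN orbT.
  apply: filterS (filterI (lip_eval_near x i (k (d s)) es) (lip_eval_near x i (d s) es)).
  move=> y /= [yk yd] _ _.
  have := ler_norm (x i (k (d s)) - x i (d s)).
  have := ler_norm (- (x i (k (d s)) - x i (d s))); rewrite normrN.
  by move: yk yd; rewrite !ltr_norml; lra.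
have near_net : nbhs x [set y : lipSeq F |
    forall s, (s < c)%N -> `|x m (d s) - y m (d s)| < e].
  apply: (@filter_forall_lt _ (nbhs x) _
    (fun s => [set y : lipSeq F | `|x m (d s) - y m (d s)| < e])) => s.
  exact: lip_eval_near.
pose near_conditions := [set y : lipSeq F | `|x m (k (d l)) - y m (k (d l))| < e] `&`
  ([set y : lipSeq F | forall s, (s < c)%N -> `|x m (d s) - y m (d s)| < e] `&`
   [set y : lipSeq F | forall i, (i < N)%N -> forall s, (s < N)%N -> P i s y]).
have near_all : nbhs x near_conditions.
  apply: filterI (lip_eval_near x m (k (d l)) e0) (filterI near_net _).
  exact: (@filter_forall_lt _ (nbhs x) _ _ N
    (fun i => @filter_forall_lt _ (nbhs x) _ _ N (xP i))).
suff : near_conditions `<=` wandering n N l j.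
  by move=> sub; exact: (@filterS _ (nbhs x) _ _ _ sub near_all).
move=> y [/= ykl [yc yP]].
exists k; split.
- by rewrite -/t [t]splitr.
- by move=> i s iN sN; exact: yP.
- exists m => q jq; have [s sc sq] := jc q jq.
  have [_ _ xL] := lipP x m; have [_ _ yL] := lipP y m.
  have := yc s sc; have := xL (d s) q; have := yL q (d s).
  rewrite (real_metric_sym q) (xN0 _ jq); move: ykl; rewrite xNk !ltr_norml.
  by move: sq; rewrite /e; lra.
Qed.

(** The sets g^-1 Q_i with g in a basic open set of isometries have a dense open
    union, so by Baire category some x lies in all these unions; this replaces a
    Kuratowski-Ulam argument. *)
Lemma exists_generic (I : countType) (Q : I -> set (lipSeq F)) :
  (forall i, open (Q i) /\ dense (Q i)) ->
  exists x, (forall i g (A : set G), nbhs g A ->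
      exists h, A h /\ Q i (lip_move h x)) /\
    forall n N l j, ~ relcompact F (spread F n (N.+1%:R^-1 / 2) (d l)) ->
      wandering n N l j x.
Proof.
move=> Qod.
pose J : countType := (I * (nat * seq nat) + nat * nat * nat * nat)%type.
pose O (j : J) : set (lipSeq F) := match j with
  | inl (i, c) => [set x | isometry_cell F c !=set0 ->
      exists2 h, isometry_cell F c h & Q i (lip_move h x)]
  | inr (n, N, l, j) => [set x |
      ~ relcompact F (spread F n (N.+1%:R^-1 / 2) (d l)) ->
      (wandering n N l j)° x] end.
have Oopen j : open (O j).
  case: j => [[i c]|[[[n N] l] j]] /=.
    have [[g cg]|nc] := pselect (isometry_cell F c !=set0); last first.
      by rewrite (_ : mkset _ = setT); [exact: openT|apply/seteqP; split=> // x _ /nc].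
    rewrite (_ : mkset _ = \bigcup_(h in isometry_cell F c) (lip_move h @^-1` Q i)).
      apply: bigcup_open => h _; apply: lip_move_continuous_lip; exact: (Qod i).1.
    apply/seteqP; split=> x /=; last by move=> [h ch Qh] _; exists h.
    by move=> []; [exists g|move=> h ch Qh; exists h].
  have [rel|nrel] := pselect (relcompact F (spread F n (N.+1%:R^-1 / 2) (d l))).
    by rewrite (_ : mkset _ = setT); [exact: openT|apply/seteqP; split=> // x _ /(_ rel)].
  rewrite (_ : mkset _ = (wandering n N l j)°); first exact: open_interior.
  by apply/seteqP; split=> x //=; apply.
have Odense j (U : set (lipSeq F)) : open U -> U `&` setT !=set0 ->
    U `&` setT `&` O j !=set0.
  rewrite setIT => oU U0; case: j => [[i c]|[[[n N] l] j]] /=.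
    have [[g cg]|nc] := pselect (isometry_cell F c !=set0); last first.
      by have [x Ux] := U0; exists x; split.
    have [x Ux] := U0.
    have oV : open (lip_move (g^-1)%g @^-1` U) by exact: lip_move_continuous_lip.
    have [|y [Uy Qy]] := (Qod i).2 (lip_move (g^-1)%g @^-1` U) _ oV.
      exists (lip_move g x); rewrite /= -lip_moveM.
      rewrite (_ : lip_move _ x = x)//; apply: lip_ext => i' p; congr (x i' _).
      by apply: (@isometry_inj R M (g^-1 * g)%g); rewrite isoKV isoM isoVK.
    exists (lip_move (g^-1)%g y); split => // _; exists g => //.
    rewrite -lip_moveM (_ : lip_move _ y = y)//.
    apply: lip_ext => i' p; congr (y i' _).
    by apply: (@isometry_inj R M (g * g^-1)%g); rewrite isoKV isoM isoKV.
  have [rel|nrel] := pselect (relcompact F (spread F n (N.+1%:R^-1 / 2) (d l))).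
    by have [x Ux] := U0; exists x; split.
  by have [x [Ux wx]] := @wandering_dense n N l j U oU U0 nrel; exists x; split.
have [x [_ _ xO]] := baire_category (metric_complete_gauge (lipSeq F))
  closedT Oopen Odense openT (ex_intro _ point (conj Logic.I Logic.I)).
exists x; split=> [i g A gA|n N l j nrel].
  have [c cg cA] := isometry_cell_near F gA.
  by have [|h ch Qh] := xO (inl (i, c)); [exists g|exists h; split=> //; exact: cA].
exact: interior_subset (xO (inr (n, N, l, j)) nrel).
Qed.

Lemma generic_orbit (I : countType) (Q : I -> set (lipSeq F)) x (W : set G) :
  (forall i, open (Q i)) ->
  (forall i g (A : set G), nbhs g A -> exists h, A h /\ Q i (lip_move h x)) ->
  open W -> W !=set0 -> exists g, W g /\ forall i, Q i (lip_move g x).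
Proof.
move=> oQ Qx oW [g Wg].
pose O i := [set g : G | Q i (lip_move g x)].
have [h [Wh _ hQ]] : exists h, [/\ W h, [set: G] h & forall i, O i h].
  apply: (baire_category (isometry_complete_gauge F) (O := O) closedT) => //.
  - by move=> i; exact: lip_move_continuous_iso.
  - move=> i U oU [h [Uh _]].
    have [h' [Uh' Qh']] := Qx i h U (open_nbhs_nbhs (conj oU Uh)).
    by exists h'.
  - by exists g.
by exists h.
Qed.

(** Otherwise, for each value u in the countable set S, the isometries g near
    which f(- x) avoids u contain a dense open set, and a generic g takes no
    value in S at all. *)
Lemma constant_on_open (I : countType) (Q : I -> set (lipSeq F)) x (Y : Type)
    (f : lipSeq F -> Y) (S : set Y) (B : nat * nat -> set Y) :
  (forall i, open (Q i)) ->
  (forall i g (A : set G), nbhs g A -> exists h, A h /\ Q i (lip_move h x)) ->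
  (forall c z, (forall i, Q i z) ->
     \forall y \near z, (forall i, Q i y) -> B c (f y) <-> B c (f z)) ->
  (forall u v, u <> v -> exists c, B c u /\ ~ B c v) ->
  countable S -> (forall g, S (f (lip_move g x))) ->
  exists (W : set G) u, [/\ open W, W !=set0 &
    forall g, W g -> (forall i, Q i (lip_move g x)) -> f (lip_move g x) = u].
Proof.
move=> oQ Qx fB sepB /countable_injP[phi phi_inj] fS; apply: contrapT => nconst.
pose D g := forall i, Q i (lip_move g x).
pose avoid m := [set g : G | D g -> forall u, S u -> phi u = m -> f (lip_move g x) <> u].
pose O (j : I + nat) : set G := match j with
  | inl i => [set g | Q i (lip_move g x)] | inr m => (avoid m)° end.
have [g [_ _ gO]] : exists g, [/\ [set: G] g, [set: G] g & forall j, O j g].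
  apply: (baire_category (isometry_complete_gauge F) (O := O) closedT) => //.
- by move=> [i|m] /=; [exact: lip_move_continuous_iso|exact: open_interior].
- move=> [i|m] U oU [h [Uh _]] /=.
    have [h' [Uh' Qh']] := Qx i h U (open_nbhs_nbhs (conj oU Uh)).
    by exists h'.
  have [[u [Su um]]|nu] := pselect (exists u, S u /\ phi u = m); last first.
    exists h; split=> //; apply: filterS filterT => g _ _ u Su um.
    by case: nu; exists u.
  have [g [Ug [Dg gu]]] : exists g, U g /\ D g /\ f (lip_move g x) <> u.
    apply: contrapT => nU; apply: nconst; exists U, u; split=> //; first by exists h.
    by move=> g Ug Dg; apply: contrapT => gu; apply: nU; exists g.
  exists g; split=> //; have [i [gi nui]] := sepB _ _ gu.
  have [V [W [gV gW VW]]] := lip_move_near (fB i _ Dg).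
  apply: filterS gV => h' Vh' Dh' u' Su' u'm h'u'.
  have uu' : u' = u by apply: phi_inj; rewrite ?inE// um.
  apply: nui; rewrite -uu' -h'u'; apply/(VW h' x Vh') => //.
  exact: nbhs_singleton.
- exact: openT.
- by exists (1%g : G).
have Dg : D g by move=> i; exact: (gO (inl i)).
have := interior_subset (gO (inr (phi (f (lip_move g x))))).
by move=> /(_ Dg _ (fS g) erefl).
Qed.

End generic_points.

(** * Closures of local orbits *)

Lemma positive_lower_bound (R : realType) (e : nat -> R) n :
  (forall s, (s < n)%N -> 0 < e s) ->
  exists2 delta : R, 0 < delta & forall s, (s < n)%N -> delta <= e s.
Proof.
elim: n => [|n ih] e0; first by exists 1.
have [s sn|delta delta0 le_e] := ih; first by apply: e0; exact: ltnW.
exists (Num.min delta (e n)); first by rewrite lt_min delta0 e0.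
move=> s; rewrite ltnS leq_eqVlt ge_min => /predU1P[->|/le_e->//].
by rewrite lexx orbT.
Qed.

Section main.
Context {R : realType} {M : metricType R} (F : frame M).
Local Notation G := (isometryGroup M).
Implicit Types (x y z : lipSeq F) (p q b : M) (g h k : G).
Local Notation d := (pts F).
Local Notation r := (crad F).

(** Multiplying g on the right by a nearly fixing isometry keeps it in an open
    set of isometries that is defined by the same points d_s. *)
Lemma nearly_fixing_right g h m (e : R) :
  (forall s, (s < m)%N -> mdist (h (d s)) (g (d s)) < e) ->
  exists2 delta : R, 0 < delta & forall k, nearly_fixing F m delta k ->
    forall s, (s < m)%N -> mdist (h (d s)) ((g * k^-1)%g (d s)) < e.
Proof.
move=> hg; have [s sm|delta delta0 le_e] :=
  @positive_lower_bound R (fun s => e - mdist (h (d s)) (g (d s))) m.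
  by rewrite subr_gt0 hg.
exists delta => // k Wk s sm; have := le_e s sm; have := Wk s sm.
have := real_metric_triangle (h (d s)) (g (d s)) ((g * k^-1)%g (d s)).
rewrite isoM isometry_dist -(isometry_dist k (d s)) isoKV.
by lra.
Qed.

Lemma relcompact_spread_near n (e : R) p q : mdist p q < r p ->
  relcompact F (spread F n e p) -> relcompact F (spread F n e q).
Proof.
move=> pq /relcompact_thicken; apply: relcompact_sub => _ [g Wg <-].
exists (g p); first by exists g.
by rewrite isometry_dist crad_isometry.
Qed.

(** If y = g x with g^-1 b in the j-th ball, then y_i(b) = x_i(g^-1 b) for all
    i, so y does not belong to this set. *)
Definition exceeds_ball x b j := [set y : lipSeq F | exists i, forall q,
  mdist (d j) q < r (d j) -> x i q < y i b].

(** Replace g by g k^-1, where k comes from [wandering] for points of the dense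
    sequence close to g^-1 d_s and to g^-1 (h b0). By [spread_shrink] the point
    g^-1 (h b0) still escapes under isometries nearly fixing the d_s to any
    precision. *)
Lemma exceeds_ball_dense x m (e : R) b0 h j :
  (forall n N l j, ~ relcompact F (spread F n (N.+1%:R^-1 / 2) (d l)) ->
      wandering n N l j x) ->
  (forall s, (s < m)%N -> e <= r (d s)) ->
  ~ relcompact F (spread F m e b0) ->
  forall g (A : set (lipSeq F)),
  (forall s, (s < m)%N -> mdist (h (d s)) (g (d s)) < e) ->
  nbhs (lip_move g x) A ->
  exists g', [/\ forall s, (s < m)%N -> mdist (h (d s)) (g' (d s)) < e,
    A (lip_move g' x) & (exceeds_ball x (h b0) j)° (lip_move g' x)].
Proof.
move=> x_wandering er escape g A hg /nbhs_lip_basis[N0 N0A].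
pose t : R := N0.+1%:R^-1; have t0 : 0 < t by rewrite invr_gt0.
have t30 : 0 < t / 3 by rewrite divr_gt0.
have [delta delta0 gk] := nearly_fixing_right hg.
pose b := ((g^-1)%g (h b0)).
have /choice[u gu] s : exists u, mdist ((g^-1)%g (d s)) (d u) < t / 3.
  exact: pts_dense.
have [l lb] : exists l, mdist (d l) b < 1 / 4 * r (d l) by apply: pts_rad; lra.
have [N1 uN1] : exists N1, forall s, (s < N0)%N -> (u s < N1)%N.
  apply: (@uniform_bound (fun s m => (u s < m)%N)) => [s n n' nn' /leq_trans|s].
    exact.
  by exists (u s).+1.
have [N2 tN2] : exists N2, N2.+1%:R^-1 < Num.min delta (t / 3).
  by apply: exists_invS; rewrite lt_min delta0 t30.
(* N must see the approximating points d_(u s), and be precise enough both to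
   keep g k^-1 in the given neighbourhood and to keep (g k^-1) x in A. *)
pose N := maxn N0 (maxn N1 N2); pose tN : R := N.+1%:R^-1.
have [tNdelta tNt] : tN < delta /\ tN < t / 3.
  have : tN < Num.min delta (t / 3).
    apply: le_lt_trans tN2; rewrite lef_pV2 ?posrE// ler_nat ltnS.
    by rewrite /N !leq_max leqnn !orbT.
  by rewrite lt_min => /andP.
have nrel : ~ relcompact F (spread F m (tN / 2) (d l)).
  have lbr : mdist (d l) b < r (d l) by have := crad_gt0 F (d l); move: lb; lra.
  move=> /(relcompact_spread_near lbr).
  rewrite (_ : b = ((h^-1 * g)^-1)%g b0); last first.
    apply: (@isometry_inj R M (h^-1 * g)%g); rewrite isoKV isoM /b isoKV.
    exact: isoVK.
  apply: (spread_shrink er) => //.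
    by rewrite divr_gt0// invr_gt0.
  by move=> s sm; rewrite mdist_isometryVM hg.
have [k [Wk xk [i xi]]] := x_wandering m N l j nrel.
pose w : G := (g * k^-1)%g.
have gkx i' p : lip_move w x i' p = x i' (k ((g^-1)%g p)).
  rewrite lip_moveE; congr (x i' _); apply: (@isometry_inj R M w).
  by rewrite isoKV isoM isoVK isoKV.
exists w; split.
- by apply: gk => s sm; exact: lt_trans (Wk s sm) tNdelta.
- apply: N0A => i' s iN0 sN0; rewrite gkx lip_moveE.
  have [_ _ xL] := lipP x i'.
  have iN : (i' < N)%N by rewrite leq_max iN0.
  have uN : (u s < N)%N by rewrite !leq_max uN1// orbT.
  have := xk i' (u s) iN uN; have := gu s.
  have := xL ((g^-1)%g (d s)) (d (u s)); have := xL (d (u s)) ((g^-1)%g (d s)).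
  have := xL (k ((g^-1)%g (d s))) (k (d (u s))).
  have := xL (k (d (u s))) (k ((g^-1)%g (d s))).
  rewrite !isometry_dist (real_metric_sym (d (u s))) !ltr_norml.
  by move: tNt; rewrite -/tN -/t; move: (tN) (t) => a c; lra.
- have e0 : 0 < r (d l) / 4 by rewrite divr_gt0// crad_gt0.
  suff sub : [set y : lipSeq F |
      `|lip_move w x i (h b0) - y i (h b0)| < r (d l) / 4] `<=`
      exceeds_ball x (h b0) j.
    exact: (@filterS _ (nbhs _) _ _ _ sub (lip_eval_near _ _ _ e0)).
  move=> y xy; have : `|x i (k b) - y i (h b0)| < r (d l) / 4.
    by rewrite -gkx; exact: xy.
  rewrite ltr_norml => {}xy; exists i => q /xi; move: xy.
  have [_ _ xL] := lipP x i; have := xL (k (d l)) (k b).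
  by rewrite isometry_dist; move: lb; lra.
Qed.

Lemma isometryGroup_locally_compact :
  (forall (d : measure_display) (X : measurableType d) (act : G -> X -> X),
      standard_borel R X -> borel_action act ->
      essentially_countable R (orbit_equivalence act)) ->
  locally_compact [set: G].
Proof.
move=> essM; apply: contrapT => nlc.
have [dY [Y [E [stdY [eqE _ countE] [f mf fE]]]]] :=
  essM _ _ _ (lip_standard_borel F) (lip_borel_action F).
have [B [mB sepB]] := standard_borel_separating stdY.
have [I [Q [Qod fQ]]] := borel_map_generically_continuous mf mB.
have oQ i : open (Q i) := (Qod i).1.
have [x [Qx x_wandering]] := exists_generic Qod.
have fS g : E (f x) (f (lip_move g x)) by apply/fE; exists g.
have [W [u [oW [h Wh] fW]]] := constant_on_open oQ Qx fQ sepB (countE (f x)) fS.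
have [m mW] := nbhs_isometry_basis F (open_nbhs_nbhs (conj oW Wh)).
have [s _|e0 e00 le_r] := @positive_lower_bound R (fun s => r (d s)) m.
  exact: crad_gt0.
pose e := Num.min e0 (m.+1%:R^-1).
have e_gt0 : 0 < e by rewrite lt_min e00 invr_gt0 ltr0n.
have er s : (s < m)%N -> e <= r (d s) by move=> sm; rewrite ge_min le_r.
have [b0 escape] : exists b0, ~ relcompact F (spread F m e b0).
  apply: contrapT => nb; apply: nlc.
  apply: (relcompact_spread_locally_compact e_gt0 (F := F) (n := m)) => b.
  by apply: contrapT => nrel; apply: nb; exists b.
pose V := [set g : G | forall s, (s < m)%N -> mdist (h (d s)) (g (d s)) < e].
have VW : V `<=` W.
  move=> g Vg; apply: mW => s sm; have := Vg s sm.
  by rewrite lt_min => /andP[].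
pose orb := [set lip_move g x | g in V].
pose O (j : I + nat) : set (lipSeq F) := match j with
  | inl i => Q i | inr j => (exceeds_ball x (h b0) j)° end.
have oV : open V.
  rewrite openE => g Vg.
  pose P s := [set g' : G | (s < m)%N -> mdist (h (d s)) (g' (d s)) < e].
  have gP s : nbhs g (P s).
    have [sm|] := boolP (s < m)%N; last first.
      by rewrite /P => /negbTE->; apply: filterS filterT.
    apply: (@filterS _ (nbhs g) _ [set g' : G | mdist (h (d s)) (g' (d s)) < e]).
      by move=> g' /= hg' _.
    by apply: open_nbhs_nbhs; split; [exact: open_isometry_eval|exact: Vg].
  apply: filterS (@filter_forall_lt _ (nbhs g) _ P m gP) => g' Pg' s sm.
  exact: Pg'.
have Vh : V h by move=> s sm; rewrite mdistxx.
have orb_meet (U : set (lipSeq F)) z : open U -> U z -> closure orb z ->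
    exists g, V g /\ U (lip_move g x).
  move=> oU Uz /(_ U (open_nbhs_nbhs (conj oU Uz)))[_ [[g Vg <-] Ug]].
  by exists g.
have Odense j (U : set (lipSeq F)) : open U -> U `&` closure orb !=set0 ->
    U `&` closure orb `&` O j !=set0.
  move=> oU [z [Uz Zz]]; have [g [Vg Ug]] := orb_meet U z oU Uz Zz.
  suff [g' [Vg' Ug' Og']] : exists g', [/\ V g', U (lip_move g' x) & O j (lip_move g' x)].
    by exists (lip_move g' x); split=> //; split=> //; apply: subset_closure; exists g'.
  case: j => [i|j].
    have oVU : open (V `&` [set g' : G | U (lip_move g' x)]).
      by apply: openI => //; exact: lip_move_continuous_iso.
    have [|g' [[Vg' Ug'] Qg']] := Qx i g _ (open_nbhs_nbhs (conj oVU _)); first by [].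
    by exists g'.
  exact: (exceeds_ball_dense j x_wandering er escape Vg (open_nbhs_nbhs (conj oU Ug))).
have [y [_ Zy yO]] : exists y, [/\ [set: lipSeq F] y, closure orb y & forall j, O j y].
  apply: (baire_category (metric_complete_gauge (lipSeq F)) (O := O)) => //.
  - exact: closed_closure.
  - by move=> [i|j]; [exact: oQ|exact: open_interior].
  - exact: openT.
  - by exists (lip_move h x); split=> //; apply: subset_closure; exists h.
have yQ i : Q i y by exact: (yO (inl i)).
(* f y is approximated by values of f on the local orbit, all of them equal to
   u. *)
have fy : f y = u.
  apply: contrapT => /sepB[c [cy ncu]].
  pose N := [set z : lipSeq F | (forall i, Q i z) -> B c (f z) <-> B c (f y)].
  have yN : nbhs y N by exact: fQ.
  have [g [Vg Ng]] := orb_meet N° y (open_interior N) yN Zy.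
  have oVN : open (V `&` [set g : G | N° (lip_move g x)]).
    by apply: openI => //; apply: lip_move_continuous_iso; exact: open_interior.
  have [|g' [[Vg' Ng'] Qg']] := generic_orbit oQ Qx oVN; first by exists g.
  by apply: ncu; rewrite -(fW g' (VW _ Vg') Qg'); apply/(interior_subset Ng' Qg').
have [|g1 [Vg1 Qg1]] := generic_orbit oQ Qx oV; first by exists h.
have /fE[g2 g12] : E (f (lip_move g1 x)) (f y).
  rewrite fy (fW g1 (VW _ Vg1) Qg1); exact: (@Equivalence_Reflexive _ _ eqE).
have [j] := pts_rad F ((g2 * g1)^-1%g (h b0)) ltr01 (lexx 1).
rewrite mul1r => jb; have [i /(_ _ jb)] := interior_subset (yO (inr j)).
by rewrite -g12 -lip_moveM lip_moveE ltxx.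
Qed.

End main.

Theorem theorem1p3 (R : realType) (M : metricType R)
    (sepM : separable_space M) (lcM : locally_compact [set: M])
    (essM : forall (d : measure_display) (X : measurableType d)
        (act : isometryGroup M -> X -> X),
      standard_borel R X -> borel_action act ->
      essentially_countable R (orbit_equivalence act)) :
  locally_compact [set: isometryGroup M].
Proof.
have [[p _]|nM] := pselect (exists p : M, True).
  have [F] := exists_frame p sepM lcM.
  exact: (isometryGroup_locally_compact F essM).
move=> g _; exists setT; first exact: filterT.
split; last exact: closedT.
(* On the empty space there is only one isometry. *)
rewrite (_ : setT = [set (1%g : isometryGroup M)]); first exact: compact_set1.
by apply/seteqP; split=> // h _; apply: isometryP => p; case: nM; exists p.
Qed.
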